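(* Let $n\ge 4$ and $2\le k\le n-2$, and let $v,w\in\mathfrak{S}_n$ satisfy $w=v(s_1s_2\cdots s_{k-1})(s_{n-1}s_{n-2}\cdots s_k)$ and $\ell(w)-\ell(v)=n-1$. Let $1\le i<j\le n$ be such that $\ell(wt_{i,j})=\ell(w)-1$ (equivalently, $w(i)>w(j)$ and $w(p)\notin[w(j),w(i)]$ for every $i<p<j$). Then $wt_{i,j}$ is a coatom of $[v,w]$ if and only if one of the following holds: (1) $1\le i<j\le k+1$, and $w(i)<w(p)$ for every $i<p<j$; (2) $k\le i<j\le n$, and $w(p)<w(j)$ for every $i<p<j$; (3) $1\le i<k$ and $k+1<j\le n$, and $w(i)<w(p)$ for every $i<p\le k$ and $w(p)<w(j)$ for every $k<p<j$. Moreover, $Q_{v,w}$ is combinatorially equivalent to a cube if and only if there is no pair $(i,j)$ with $\ell(wt_{i,j})=\ell(w)-1$ satisfying (3).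
   Context: $\mathfrak{S}_n$ is the symmetric group on $\{1,\dots,n\}$ with product given by composition $(uz)(k)=u(z(k))$, $t_{i,j}=(i,j)$ is the transposition swapping $i$ and $j$, $s_i=t_{i,i+1}$ are the simple transpositions, $\ell(\cdot)$ is the length with respect to them, and $\le$ is Bruhat order. For $v\le w$, $[v,w]=\{z\in\mathfrak{S}_n\mid v\le z\le w\}$; a coatom of $[v,w]$ is an element of $[v,w]$ covered by $w$. The Bruhat interval polytope $Q_{v,w}$ is the convex hull in $\mathbb{R}^n$ of the points $(z(1),\dots,z(n))$ for $z\in[v,w]$. Two polytopes are combinatorially equivalent if their face posets are isomorphic. *)

(* Defs.v *)
From mathcomp Require Import all_boot all_order all_algebra all_fingroup.
From mathcomp Require Import classical_sets reals.

Set Implicit Arguments.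
Unset Strict Implicit.
Unset Printing Implicit Defensive.

Import Order.TTheory GRing.Theory Num.Theory.

Local Open Scope nat_scope.

(* 'S_n acts on {0, ..., n-1}; the index i : 'I_n stands for the element i.+1
   of {1, ..., n}, and likewise for values of permutations. *)

Section Bruhat.

Variable n : nat.
Implicit Types (u v w x z : 'S_n) (i j : 'I_n).

(* MathComp's product applies the left factor first: (s * t) x = t (s x).
   Here (u \ou z) k = u (z k). *)
Definition pmul u z : 'S_n := (z * u)%g.

Lemma pmulE u z i : pmul u z i = u (z i).
Proof. by rewrite permM. Qed.

(* s_a = (a, a+1) for 1 <= a < n; the identity for other values of a. *)
Definition s_ (a : nat) : 'S_n :=
  if (insub a.-1, insub a) is (Some i, Some j) then tperm i j else 1%g.

Lemma s_E i j : j = i.+1 :> nat -> s_ j = tperm i j.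
Proof.
move=> ij; rewrite /s_ ij /=.
have -> : insub (i : nat) = Some i by exact: valK.
by rewrite -ij; have -> : insub (j : nat) = Some j by exact: valK.
Qed.

(* u is a product of m simple transpositions; c : 'I_n.-1 encodes s_(c+1). *)
Definition has_word u (m : nat) : bool :=
  [exists t : m.-tuple 'I_n.-1, u == \big[pmul/1%g]_(c <- t) s_ c.+1].

Lemma exists_word u : exists m, has_word u m.
Proof.
pose W x := exists r : seq 'I_n.-1, x = \big[pmul/1%g]_(c <- r) s_ c.+1.
suff [r ->] : W u.
  by exists (size r); apply/existsP; exists (in_tuple r).
have W1 : W 1%g by exists [::]; rewrite big_nil.
have WM x z : W x -> W z -> W (x * z)%g.
  move=> [r ->] [r' ->]; exists (r' ++ r).
  elim: r' => [|c r' IH]; first by rewrite big_nil mulg1.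
  by rewrite /= !big_cons -IH /pmul mulgA.
have Ws i j : j = i.+1 :> nat -> W (tperm i j).
  move=> ij; have hi : i < n.-1 by rewrite ltn_predRL -ij.
  exists [:: Ordinal hi]; rewrite big_cons big_nil /= /pmul mul1g.
  by rewrite -(s_E ij) ij.
have Wt d : forall i j, j = i + d.+1 :> nat -> W (tperm i j).
  elim: d => [|d IH] i j ij; first by apply: Ws; rewrite ij addn1.
  have hk : i + d.+1 < n by rewrite (leq_ltn_trans _ (ltn_ord j)) // ij !addnS.
  have kj : W (tperm (Ordinal hk) j) by apply: Ws; rewrite ij /= addnS.
  have ik : W (tperm i (Ordinal hk)) by exact: IH.
  have -> : tperm i j = (tperm i (Ordinal hk) ^ tperm (Ordinal hk) j)%g.
    rewrite tpermJ tpermL tpermD //; rewrite -val_eqE /= ?ij.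
      by rewrite gtn_eqF // -addSnnS leq_addr.
    by rewrite gtn_eqF // -addSnnS leq_addr.
  by rewrite conjgE tpermV; apply: (WM) => //; apply: (WM).
have [ts -> _] := prod_tpermP u.
elim: ts => [|[i j] ts IH]; first by rewrite big_nil.
rewrite big_cons; apply: (WM) => //=.
case: (ltngtP i j) => [ij|ji|/val_inj ->]; last by rewrite tperm1.
- by apply: (Wt (j - i).-1); rewrite prednK ?subn_gt0 // subnKC // ltnW.
- by rewrite tpermC; apply: (Wt (i - j).-1); rewrite prednK ?subn_gt0 // subnKC // ltnW.
Qed.

Definition ell u : nat := ex_minn (exists_word u).

Definition bruhat_step : rel 'S_n := fun u z =>
  [exists i, exists j, z == pmul u (tperm i j)] && (ell u < ell z).

Definition bruhat_le : rel 'S_n := connect bruhat_step.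

Definition bruhat_lt : rel 'S_n := fun u z => (u != z) && bruhat_le u z.

Definition bruhat_covers u z : bool :=
  bruhat_lt u z && ~~ [exists x, bruhat_lt u x && bruhat_lt x z].

Definition bruhat_interval v w : {set 'S_n} :=
  [set z | bruhat_le v z && bruhat_le z w].

Definition coatom v w x : bool :=
  (x \in bruhat_interval v w) && bruhat_covers x w.

End Bruhat.

Notation "u \ou z" := (pmul u z) (at level 40, left associativity).

Section Polytopes.

Variable R : realType.
Local Open Scope ring_scope.
Local Open Scope classical_set_scope.

Definition dot d (c x : 'rV[R]_d) : R := \sum_i c 0 i * x 0 i.

Definition conv_hull (I : finType) d (A : {set I}) (p : I -> 'rV[R]_d) :
    set 'rV[R]_d :=
  [set x | exists a : I -> R,
     [/\ forall z, z \in A -> 0 <= a z,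
         \sum_(z in A) a z = 1
       & x = \sum_(z in A) a z *: p z]].

Definition bruhat_polytope n (v w : 'S_n) : set 'rV[R]_n :=
  conv_hull (bruhat_interval v w) (fun z : 'S_n => \row_i (z i).+1%:R).

Definition cube d : set 'rV[R]_d := [set x | forall i, 0 <= x 0 i <= 1].

(* The functional c may be 0, so that P itself (b = 0) and the empty set
   (b = 1) are faces of P. *)
Definition face d (P F : set 'rV[R]_d) : Prop :=
  exists (c : 'rV[R]_d) (b : R),
    (forall x, P x -> dot c x <= b) /\ F = P `&` [set x | dot c x = b].

Definition comb_equiv d e (P : set 'rV[R]_d) (Q : set 'rV[R]_e) : Prop :=
  exists f : set 'rV[R]_d -> set 'rV[R]_e,
    [/\ forall F, face P F -> face Q (f F),
        forall G, face Q G -> exists2 F, face P F & f F = G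
      & forall F F', face P F -> face P F' -> (f F `<=` f F' <-> F `<=` F')].

End Polytopes.

Arguments bruhat_polytope R {n} v w.
Arguments cube R d : clear implicits.

(* Main.v *)
Require Import Defs.
From mathcomp Require Import all_boot all_order all_algebra all_fingroup.
From mathcomp Require Import boolp classical_sets reals.
From HB Require Import structures.
From mathcomp Require Import zify ring lra.

(* Write m = w(k+1) = v(1) and M = w(k) = v(n). The word w is v with m moved
   rightwards to position k+1 and M leftwards to position k, and the length
   condition says exactly that every transposition met on the way is an ascent.
   Prefix counts of v and w thus differ by one explicit entry on each side, and
   the tableau criterion for v <= w t_{i,j} becomes conditions (1)-(3).

   The coatoms of types (1) and (2) form a spanning tree on the positions: each
   p <= k is joined to the next smaller entry, each p > k to the previous larger
   one, and (k, k+1) is the common edge. Without a coatom of type (3), running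
   through the tree edges in a suitable order and exchanging or not exchanging
   the two entries at each edge produces 2^(n-1) elements of [v, w]. Each edge
   e cuts the tree into two parts; the sum of the entries over one of them is at
   most its value at w on all of [v, w], with equality at the vertices that do
   not use e. A second set of positions gives, in the same way, an inequality
   tight at the vertices that use e. These n-1 pairs of opposite facets,
   together with dim Q <= n-1, determine the face lattice to be that of a cube.

   A coatom w t_{i,j} of type (3) gives four neighbours of w, obtained from
   (i, j), (k, k+1), (i, k+1), (k, j), whose edge directions satisfy
   (e_i - e_j) + (e_k - e_{k+1}) = (e_i - e_{k+1}) + (e_k - e_j). So a face
   containing the edges (i, k+1) and (k, j) contains the edge (k, k+1), whereas
   in a cube an atom above a vertex is not below the join of two others. *)

Set Implicit Arguments.
Unset Strict Implicit.
Unset Printing Implicit Defensive.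

Local Open Scope nat_scope.

(** * Length *)

Section Length.

Variable n : nat.
Implicit Types (u v w x z : 'S_n) (i j p q a b c : 'I_n).

(** Bruhat order compares prefixes, whereas the facets concern sums over other sets of positions.
    The bridge is that prefix sums of every monotone function of the entries grow along Bruhat
    order. Truncating the entries at a well chosen threshold makes the relevant prefixes of [v] and
    [w] comparable, and a sum over an interval becomes a difference of two prefix sums bounded in
    opposite directions. The exchanges interact, since the entry found at a node depends on earlier
    choices. The order of the edges makes every exchange a descent whatever these choices were. Only
    at the common edge can both ends have been disturbed; there the absence of a coatom of type (3)
    decides, and it also supplies the threshold for the facet of that edge. Membership in [[v, w]]
    is not tested product by product: using more edges moves down in Bruhat order, and using all of
    them gives [v]. *)

Lemma pmulA : associative (@pmul n).
Proof. by move=> x y z; rewrite /pmul mulgA. Qed.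

Lemma pmul1u : left_id 1%g (@pmul n).
Proof. by move=> x; rewrite /pmul mulg1. Qed.

Lemma pmulu1 : right_id 1%g (@pmul n).
Proof. by move=> x; rewrite /pmul mul1g. Qed.

HB.instance Definition _ := Monoid.isLaw.Build 'S_n 1%g (@pmul n)
  pmulA pmul1u pmulu1.

Lemma pmul_tpermK u i j : u \ou tperm i j \ou tperm i j = u.
Proof. by rewrite /pmul mulgA tperm2 mul1g. Qed.

Definition inv u : nat := \sum_(p < n) \sum_(q < n) ((p < q) && (u q < u p)).

Lemma sum_D2 (G : 'I_n -> nat) i j : i != j ->
  \sum_(p < n) G p = G i + G j + \sum_(p < n | (p != i) && (p != j)) G p.
Proof. by move=> ij; rewrite (bigD1 i) //= (bigD1 j) 1?eq_sym //= addnA. Qed.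

Lemma sum_pairs_D2 (F : 'I_n -> 'I_n -> nat) i j : i != j ->
  \sum_(p < n) \sum_(q < n) F p q =
    \sum_(p < n | (p != i) && (p != j)) \sum_(q < n | (q != i) && (q != j)) F p q
    + \sum_(p < n | (p != i) && (p != j)) (F p i + F p j + F i p + F j p)
    + (F i i + F i j + F j i + F j j).
Proof.
move=> ij; have D2 G := sum_D2 G ij.
rewrite D2 !D2 (eq_bigr _ (fun p _ => D2 (F p))) !big_split /=.
lia.
Qed.

Lemma perm_neq u i j : i != j -> u i != u j :> nat.
Proof. by rewrite val_eqE (inj_eq perm_inj). Qed.

(** Pairs are sorted by how they meet [{i, j}]. A third position matters only if it lies between [i]
    and [j] both in place and in value, and then two inversions vanish; the pair [(i, j)] itself is
    one more. *)
Lemma inv_tperm u i j : i < j -> u j < u i ->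
  inv u = (inv (u \ou tperm i j)).+1
          + (\sum_(p < n | (i < p < j) && (u j < u p < u i)) 1).*2.
Proof.
move=> ij uij; have nij : i != j by rewrite -val_eqE /= ltn_eqF.
rewrite /inv !(sum_pairs_D2 _ nij) !pmulE tpermL tpermR.
have E1 p : (p != i) && (p != j) -> (u \ou tperm i j) p = u p.
  by case/andP=> pi pj; rewrite pmulE tpermD // eq_sym.
rewrite [X in _ = (X + _ + _).+1 + _](_ : _ =
   \sum_(p < n | (p != i) && (p != j)) \sum_(q < n | (q != i) && (q != j))
     ((p < q) && (u q < u p))); last first.
  by apply: eq_bigr => p /E1 ->; apply: eq_bigr => q /E1 ->.
rewrite [X in _ + X + _ = _](_ : _ =
   \sum_(p < n | (p != i) && (p != j))
    ((p < i) && (u j < u p) + ((p < j) && (u i < u p)) +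
     ((i < p) && (u p < u j)) + ((j < p) && (u p < u i)))
   + \sum_(p < n | (p != i) && (p != j))
     ((i < p < j) && (u j < u p < u i)).*2); last first.
  rewrite -big_split /=; apply: eq_bigr => p /andP[pi pj].
  have := perm_neq u pi; have := perm_neq u pj.
  move: pi pj; rewrite -!val_eqE /=.
  move: ij uij; clear; lia.
rewrite [X in _ + (X + _) + _ = _](_ : _ =
   \sum_(p < n | (p != i) && (p != j)) ((p < i) && ((u \ou tperm i j) i < (u \ou tperm i j) p) +
    ((p < j) && ((u \ou tperm i j) j < (u \ou tperm i j) p)) + 
    ((i < p) && ((u \ou tperm i j) p < (u \ou tperm i j) i)) +
    ((j < p) && ((u \ou tperm i j) p < (u \ou tperm i j) j)))); last first.
  by apply: eq_bigr => p /E1 ->; rewrite !pmulE tpermL tpermR.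
have -> : (\sum_(p < n | (i < p < j) && (u j < u p < u i)) 1).*2
          = \sum_(p < n | (p != i) && (p != j)) ((i < p < j) && (u j < u p < u i)).*2.
  rewrite -mul2n big_distrr /= [RHS]big_mkcond [LHS]big_mkcond /=.
  apply: eq_bigr => p _; rewrite -!val_eqE /=.
  by case: ltngtP => //= *; case: ltngtP => //= *; case: ifP => // *; lia.
by rewrite !pmulE tpermL tpermR; lia.
Qed.

Lemma s_tperm (c : 'I_n.-1) :
  exists i j, j = i.+1 :> nat /\ s_ n c.+1 = tperm i j.
Proof.
have h : c < n.-1 := ltn_ord c.
have hi : c < n by lia.
have hj : c.+1 < n by lia.
by exists (Ordinal hi), (Ordinal hj); split=> //; rewrite -(@s_E _ (Ordinal hi)).
Qed.

Lemma inv_adjacent u i j : j = i.+1 :> nat ->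
  inv (u \ou tperm i j) =
    if u i < u j then (inv u).+1 else (inv u).-1.
Proof.
move=> ij; have lij : i < j by rewrite ij.
have nij : i != j by rewrite -val_eqE /= ltn_eqF.
have big0 v : \sum_(p < n | (i < p < j) && (v j < v p < v i)) 1 = 0.
  by rewrite big1 // => p /andP[/andP[ip]]; rewrite ij ltnS leqNgt ip.
case: ltngtP (perm_neq u nij) => // h _.
  have := @inv_tperm (u \ou tperm i j) i j lij.
  by rewrite pmul_tpermK !pmulE tpermL tpermR => /(_ h) ->; rewrite big1 ?addn0 // => p;
    rewrite ij => /andP[/andP[ip]]; rewrite ltnS leqNgt ip.
by rewrite (inv_tperm lij h) big0 addn0.
Qed.

Lemma inv1 : inv 1%g = 0.
Proof.
rewrite /inv big1 // => p _; rewrite big1 // => q _.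
by rewrite !perm1; case: ltngtP.
Qed.

Lemma inv_word (r : seq 'I_n.-1) :
  inv (\big[@pmul n/1%g]_(c <- r) s_ n c.+1) <= size r.
Proof.
elim/last_ind: r => [|r c IH]; first by rewrite big_nil inv1.
rewrite -cats1 big_cat big_seq1 size_cat addn1 /=.
have [i [j [ij ->]]] := s_tperm c.
rewrite inv_adjacent //; case: ifP => _; first exact: IH.
exact: leq_trans (leq_pred _) (leqW IH).
Qed.

(** If [a] is the least moved point, then [u a > a], while the value [a] sits at some [b > a].
    Without an adjacent descent [u] would increase from [a] to [b]. *)
Lemma descent_exists u : u != 1%g -> exists i j, j = i.+1 :> nat /\ u j < u i.
Proof.
move=> u1.
have [a ua] : exists a, u a != a.
  apply/existsP; rewrite -negb_forall; apply: contra u1 => /forallP h.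
  by apply/eqP/permP => a; rewrite perm1; apply/eqP.
case: (arg_minnP (P := fun a => u a != a) (fun a => val a) ua) => {ua}a ua amin.
have fixlt b : b < a -> u b = b.
  by move=> ba; apply/eqP; apply/negPn/negP => /amin; rewrite leqNgt ba.
have aua : a < u a.
  case: (ltngtP a (u a)) => // [h|/val_inj h]; last by rewrite -h eqxx in ua.
  by move/fixlt/perm_inj: h ua => ->; rewrite eqxx.
pose b := (u^-1)%g a; have ub : u b = a by rewrite permKV.
have ab : a < b.
  case: (ltngtP a b) => // [h|/val_inj h].
    by have hb := fixlt _ h; rewrite -hb ub ltnn in h.
  by move: ua; rewrite -{2}ub -h eqxx.
case: (boolP [exists i : 'I_n, exists j : 'I_n, (j == i.+1 :> nat) && (u j < u i)]).
  by case/existsP=> i /existsP[j /andP[/eqP ij uij]]; exists i, j.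
move=> hno; suff: u a <= u b by rewrite ub leqNgt aua.
have mono d : forall c : 'I_n, c = a + d :> nat -> u a <= u c.
  elim: d => [|d IH] c hc; first by have -> : c = a by apply: val_inj; rewrite /= hc addn0.
  have hd : a + d < n by rewrite (leq_trans _ (ltn_ord c)) // hc addnS.
  apply: (leq_trans (IH (Ordinal hd) erefl)).
  rewrite leqNgt; apply: contra hno => h.
  by apply/existsP; exists (Ordinal hd); apply/existsP; exists c; apply/andP; split=> //; apply/eqP; rewrite hc addnS.
by apply: (mono (b - a)); rewrite subnKC // ltnW.
Qed.

Lemma word_inv u : exists r : seq 'I_n.-1,
  u = \big[@pmul n/1%g]_(c <- r) s_ n c.+1 /\ size r = inv u.
Proof.
have [m] := ubnP (inv u); elim: m u => // m IH u um.
have [->|/descent_exists[i [j [ij uij]]]] := eqVneq u 1%g.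
  by exists [::]; rewrite big_nil inv1.
have lij : i < j by rewrite ij.
have hu := inv_tperm lij uij.
have [|r [hr sr]] := IH (u \ou tperm i j); first by lia.
have hi : i < n.-1 by have := ltn_ord j; lia.
exists (rcons r (Ordinal hi)); rewrite size_rcons sr -cats1 big_cat big_seq1.
rewrite -hr /= -ij (s_E ij) pmul_tpermK; split=> //.
by rewrite inv_adjacent // ltnNge (ltnW uij) /=; lia.
Qed.

(** A simple factor raises the inversion number by at most one, and removing adjacent descents one
    by one writes [u] with [inv u] factors. *)
Lemma ellE u : ell u = inv u.
Proof.
rewrite /ell; case: ex_minnP => m /existsP[t /eqP ut] mmin.
apply/eqP; rewrite eqn_leq; apply/andP; split.
  have [r [ur sr]] := word_inv u; apply: mmin; rewrite -sr.
  by apply/existsP; exists (in_tuple r); apply/eqP.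
by have := inv_word t; rewrite size_tuple ut.
Qed.

Lemma ell_tperm u i j : i < j -> u j < u i ->
  ell u = (ell (u \ou tperm i j)).+1
          + (\sum_(p < n | (i < p < j) && (u j < u p < u i)) 1).*2.
Proof. by rewrite !ellE; apply: inv_tperm. Qed.

Lemma ell_tperm_lt u i j : i < j -> u j < u i -> ell (u \ou tperm i j) < ell u.
Proof. by move=> ij uij; rewrite (ell_tperm ij uij); lia. Qed.

Lemma ell_tperm_gt u i j : i < j -> u i < u j -> ell u < ell (u \ou tperm i j).
Proof.
move=> ij uij; rewrite -{1}[u](pmul_tpermK u i j); apply: ell_tperm_lt => //.
by rewrite !pmulE tpermL tpermR.
Qed.

Lemma ell_cover u i j : i < j ->
  (ell (u \ou tperm i j)).+1 = ell u <->
  u j < u i /\ forall p, i < p < j -> ~~ (u j <= u p <= u i).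
Proof.
move=> ij; have nij : i != j by rewrite -val_eqE /= ltn_eqF.
case: (ltngtP (u i) (u j)) (perm_neq u nij) => // h _.
  by have := ell_tperm_gt ij h; split=> [|[]]; lia.
rewrite (ell_tperm ij h); split=> [E|[_ hp]].
  split=> // p ipj; apply/negP => up.
  have pi : p != i by rewrite -val_eqE /=; lia.
  have pj : p != j by rewrite -val_eqE /=; lia.
  have := perm_neq u pi; have := perm_neq u pj => upj upi.
  move: E; rewrite (bigD1 p) /=; first by lia.
  by rewrite ipj /=; lia.
by rewrite big1 ?addn0 // => p /andP[/hp]; lia.
Qed.

Lemma ell_tperm_ltE u i j : i < j ->
  (ell (u \ou tperm i j) < ell u) = (u j < u i).
Proof.
move=> ij; have nij : i != j by rewrite -val_eqE /= ltn_eqF.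
case: (ltngtP (u i) (u j)) (perm_neq u nij) => // h _.
  by have := ell_tperm_gt ij h; lia.
by rewrite ell_tperm_lt.
Qed.

Lemma ell_adjacent_gt u i j : j = i.+1 :> nat ->
  ell (u \ou tperm i j) <= (ell u).+1 ?= iff (u i < u j).
Proof.
move=> ij; rewrite !ellE inv_adjacent //; split; case: ifP => _; lia.
Qed.

End Length.

(** * The tableau criterion *)

Section BruhatCriterion.

Variable n : nat.
Implicit Types (u v w x z : 'S_n) (i j p q a b c : 'I_n).

(** [F = leq q] gives the counts of the tableau criterion; the identity and truncations give the
    linear inequalities. The length [p] is a natural number, so that the full prefix is included. *)
Definition pre (F : nat -> nat) z (p : nat) : nat := \sum_(i < n | i < p) F (z i).

Lemma preE F z (p : nat) : pre F z p = \sum_(i < n) (if i < p then F (z i) else 0).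
Proof. by rewrite /pre big_mkcond. Qed.

Lemma pre0 F z : pre F z 0 = 0.
Proof. by rewrite /pre big_pred0. Qed.

Lemma preS F z i : pre F z i.+1 = pre F z i + F (z i).
Proof.
rewrite /pre (bigD1 i) //= addnC; congr (_ + _); apply: eq_bigl => p.
by rewrite -val_eqE /=; lia.
Qed.

Lemma pre_full F z (p : nat) : n <= p -> pre F z p = \sum_(i < n) F i.
Proof.
move=> np; rewrite /pre (reindex_inj (@perm_inj _ (z^-1)%g)) /=.
apply: eq_big => [i|i _]; last by rewrite permKV.
by rewrite (leq_trans (ltn_ord _) np).
Qed.

Lemma pre_tperm F z i j (p : nat) : i < j ->
  pre F (z \ou tperm i j) p + (if i < p <= j then F (z i) else 0) =
  pre F z p + (if i < p <= j then F (z j) else 0).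
Proof.
move=> ij; have nij : i != j by rewrite -val_eqE /= ltn_eqF.
rewrite !preE !(sum_D2 _ nij) !pmulE tpermL tpermR.
rewrite [X in _ + X + _ = _](_ : _ =
  \sum_(p0 < n | (p0 != i) && (p0 != j)) (if p0 < p then F (z p0) else 0)).
  by case: (leqP p i); case: (leqP p j) => //=; lia.
apply: eq_bigr => q /andP[qi qj].
by rewrite pmulE tpermD // eq_sym.
Qed.

Lemma bruhat_stepP u z : bruhat_step u z ->
  exists i j, [/\ i < j, u i < u j & z = u \ou tperm i j].
Proof.
case/andP=> /existsP[i /existsP[j /eqP->]] h.
case: (ltngtP i j) => [ij|ji|/val_inj ij].
- exists i, j; split=> //; move: h; rewrite -{1}[u](pmul_tpermK u i j).
  by rewrite ell_tperm_ltE // !pmulE tpermL tpermR.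
- exists j, i; split; rewrite 1?tpermC //.
  move: h; rewrite -{1}[u](pmul_tpermK u i j) tpermC.
  by rewrite ell_tperm_ltE // !pmulE tpermL tpermR.
- by move: h; rewrite ij tperm1 pmulu1 ltnn.
Qed.

Lemma bruhat_tperm u i j : i < j -> u i < u j -> bruhat_le u (u \ou tperm i j).
Proof.
move=> ij uij; apply: connect1; apply/andP; split; last exact: ell_tperm_gt.
by apply/existsP; exists i; apply/existsP; exists j.
Qed.

Lemma bruhat_refl u : bruhat_le u u.
Proof. exact: connect0. Qed.

Lemma bruhat_trans : transitive (@bruhat_le n).
Proof. exact: connect_trans. Qed.

Lemma bruhat_ind (P : 'S_n -> 'S_n -> Prop) :
  (forall u, P u u) -> (forall y x z, P x y -> P y z -> P x z) ->
  (forall u z, bruhat_step u z -> P u z) ->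
  forall u z, bruhat_le u z -> P u z.
Proof.
move=> P0 Pt P1 u z /connectP[s].
elim: s u => [|y s IH] u /=; first by move=> _ ->.
by case/andP=> uy ys zE; apply: (Pt y); [exact: P1|exact: IH].
Qed.

(** An upward step moves the larger of two entries to the earlier position, so no prefix loses. *)
Lemma pre_mono F u z (p : nat) : {homo F : x y / x <= y} ->
  bruhat_le u z -> pre F u p <= pre F z p.
Proof.
move=> hF; move: u z; apply: bruhat_ind => // [y x z|u z].
  exact: leq_trans.
case/bruhat_stepP=> i [j [ij uij ->]]; have := pre_tperm F u p ij.
by have := hF _ _ (ltnW uij); case: ifP => _; lia.
Qed.

Lemma bruhat_ell u z : bruhat_le u z -> u = z \/ ell u < ell z.
Proof.
move: u z; apply: bruhat_ind => [u|y x z|u z]; first by left.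
  by move=> [->|xy] [<-|yz]; auto; right; exact: ltn_trans yz.
by case/andP=> _; right.
Qed.

(** Greedy ascent: at the first position [a] where [v] and [z] differ, exchange [v a] with the
    nearest later entry whose value lies in [(v a, z a]]. The counts stay below those of [z], and
    the induction runs on the room left below the maximal length. *)
Theorem bruhat_criterion v z :
  (forall p q : nat, pre (leq q) v p <= pre (leq q) z p) -> bruhat_le v z.
Proof.
pose N := \max_(u : 'S_n) ell u.
have N_ell u : ell u <= N by exact: leq_bigmax.
have [m] := ubnP (N - ell v).
elim: m v => // m IH v vm cnt.
have [->|vz] := eqVneq v z; first exact: bruhat_refl.
have [a0 va0] : exists a, v a != z a.
  apply/existsP; rewrite -negb_forall; apply: contra vz => /forallP h.
  by apply/eqP/permP => a; apply/eqP.
case: (arg_minnP (P := fun a => v a != z a) (fun a => val a) va0) => {va0 a0} a va amin.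
have fixlt b : b < a -> v b = z b.
  by move=> ba; apply/eqP; apply/negPn/negP => /amin; rewrite leqNgt ba.
have prea (q : nat) : pre (leq q) v a = pre (leq q) z a.
  by apply: eq_bigr => b /fixlt ->.
have vaz : v a < z a.
  have := cnt a.+1 (v a); rewrite !preS prea leqnn leq_add2l lt0b.
  by rewrite leq_eqVlt val_eqE (negPf va).
pose c := (v^-1)%g (z a); have vc : v c = z a by rewrite permKV.
have ac : a < c.
  case: (ltngtP a c) => // [h|/val_inj h].
    by have := fixlt _ h; rewrite vc => /perm_inj h'; rewrite -h' ltnn in h.
  by rewrite -vc -h ltnn in vaz.
have Pc : (a < c) && (v a < v c <= z a) by rewrite ac vc vaz leqnn.
case: (arg_minnP (P := fun b => (a < b) && (v a < v b <= z a)) (fun b => val b) Pc).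
move=> b /andP[ab /andP[vab vbz]] bmin {c vc ac Pc}.
apply: (@bruhat_trans (v \ou tperm a b)); first exact: bruhat_tperm.
apply: IH.
  have := ell_tperm_gt ab vab.
  by have := N_ell (v \ou tperm a b); lia.
move=> p q; have := pre_tperm (leq q) v p ab; have := cnt p q.
case: ifP => [/andP[ap pb]|_]; last by lia.
case: (leqP q (v a)) => [|qa]; first by lia.
case: (leqP q (v b)) => [qb|]; last by lia.
(* In this critical range the inequality is strict: between [a] and [b] no entry of [v] has its
   value in [(v a, z a]], whereas [z] has [z a] at [a]. *)
have [] : pre (leq q) v p + 1 <= pre (leq q) z p; last by lia.
have split_pre y : pre (leq q) y p =
    pre (leq (z a).+1) y p + \sum_(x < n | x < p) (q <= y x <= z a).
  rewrite /pre -big_split /=; apply: eq_bigr => x _.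
  by move: (leq_trans qb vbz); lia.
rewrite !split_pre -addnA leq_add //.
have -> : 1 = \sum_(x < n | x < p) (x == a).
  by rewrite (bigD1 a) //= eqxx big1 // => x /andP[_ /negPf->].
rewrite -big_split /=; apply: leq_sum => x xp.
case: (ltngtP x a) => [xa|ax|/val_inj ->].
- by rewrite fixlt // -val_eqE (ltn_eqF xa) addn0.
- rewrite -val_eqE (gtn_eqF ax) addn0.
  have := bmin x; rewrite ax /=; lia.
- by rewrite eqxx; lia.
Qed.

End BruhatCriterion.

(** * The Coxeter word *)

(* Innermost conditions first: an outer condition may contain a conditional. *)
Ltac case_ifs := repeat
  match goal with |- context [if ?b then _ else _] =>
    lazymatch b with
    | context [if _ then _ else _] => fail
    | _ => case: (boolP b) => ?
    end
  end.

Section CoxeterWord.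

Variable n : nat.
Implicit Types (u v w x z : 'S_n) (i j : 'I_n).

Lemma s_val l i : 0 < l < n ->
  s_ n l i = (if i.+1 == l then l else if i == l :> nat then l.-1 else i) :> nat.
Proof.
case/andP=> l0 ln; have hl : l.-1 < n by lia.
have -> : s_ n l = tperm (Ordinal hl) (Ordinal ln) by rewrite -s_E //= prednK.
case: tpermP => [->|->|] /=.
- by rewrite prednK ?eqxx.
- by rewrite eqxx; case: eqP => //; lia.
- move=> /eqP; rewrite -val_eqE /= => h1 /eqP; rewrite -val_eqE /= => h2.
  by case: eqP; [lia|case: eqP; lia].
Qed.

Lemma cycle_up_val l i : 0 < l <= n ->
  (\big[@pmul n/1%g]_(a <- index_iota 1 l) s_ n a) i =
    (if i.+1 < l then i.+1 else if i.+1 == l then 0 else i) :> nat.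
Proof.
elim: l i => // -[|l] IH i /andP[_ ln].
  by rewrite big_geq // perm1; case: ifP => //; case: eqP => //; lia.
rewrite big_nat_recr //= pmulE IH; last by lia.
by rewrite s_val; [case_ifs; lia | lia].
Qed.

Lemma rev_index_iotaS l : l < n ->
  rev (index_iota l n) = rcons (rev (index_iota l.+1 n)) l.
Proof.
move=> ln; rewrite -rev_cons /index_iota.
by have -> : n - l = (n - l.+1).+1 by lia.
Qed.

Lemma big_rev_iotaS l : l < n ->
  \big[@pmul n/1%g]_(a <- rev (index_iota l n)) s_ n a =
  (\big[@pmul n/1%g]_(a <- rev (index_iota l.+1 n)) s_ n a) \ou s_ n l.
Proof. by move=> /rev_index_iotaS ->; rewrite -cats1 big_cat big_seq1. Qed.

Lemma cycle_down_val d l i : l + d = n -> 0 < l ->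
  (\big[@pmul n/1%g]_(a <- rev (index_iota l n)) s_ n a) i =
    (if i.+1 < l then i : nat else if i.+1 == l then n.-1 else i.-1) :> nat.
Proof.
elim: d l i => [|d IH] l i ldn l0.
  rewrite addn0 in ldn; rewrite ldn /index_iota subnn big_nil perm1.
  by have := ltn_ord i; case_ifs; lia.
rewrite big_rev_iotaS; last by lia.
rewrite pmulE IH //; last by lia.
by have := ltn_ord i; rewrite s_val; [case_ifs; lia | lia].
Qed.

(** Turns the length hypothesis into ascents: a factor raises the length by at most one, so a total
    rise equal to the number of factors forces a rise at each of them. *)
Lemma slow_steps (f : nat -> nat) T : (forall t, t < T -> f t.+1 <= (f t).+1) ->
  f T <= f 0 + T /\ (f T = f 0 + T -> forall t, t < T -> f t.+1 = (f t).+1).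
Proof.
elim: T => [|T IH] h; first by rewrite addn0.
have [|h1 h2] := IH; first by move=> t tT; apply: h; lia.
have hT := h T (ltnSn T).
split; first by lia.
move=> E t; rewrite ltnS leq_eqVlt => /orP[/eqP->|tT]; first by lia.
by apply: h2 => //; lia.
Qed.

Lemma ell_s_le u l : 0 < l < n -> ell (u \ou s_ n l) <= (ell u).+1.
Proof.
move=> /andP[l0 ln]; have hl : l.-1 < n by lia.
have -> : s_ n l = tperm (Ordinal hl) (Ordinal ln) by rewrite -s_E //= prednK.
by apply: (ell_adjacent_gt u); rewrite /= prednK.
Qed.

Lemma ell_s_eq u l i j : ell (u \ou s_ n l) = (ell u).+1 ->
  i.+1 = l -> j = l :> nat -> u i < u j.
Proof.
move=> E il jl; have ij : j = i.+1 :> nat by rewrite il.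
have := ell_adjacent_gt u ij; rewrite -(s_E ij) jl E => -[_ <-].
exact: eqxx.
Qed.

Variables (k : nat) (v w : 'S_n).
Hypothesis hk : 0 < k < n.
Hypothesis hw : w = v \ou (\big[@pmul n/1%g]_(a <- index_iota 1 k) s_ n a)
                \ou (\big[@pmul n/1%g]_(a <- rev (index_iota k n)) s_ n a).
Hypothesis hl : ell w = ell v + (n - 1).

(** In zero-based one-line form [w] is v_1, ..., v_{k-1}, v_{n-1}, v_0, v_k, ..., v_{n-2}. *)
Lemma wE i : exists j, [/\ w i = v j & 
  j = (if i.+1 < k then i.+1 else if i.+1 == k then n.-1
       else if i == k :> nat then 0 else i.-1) :> nat].
Proof.
rewrite hw -pmulA pmulE; eexists; split; first by [].
rewrite pmulE cycle_up_val; last by lia.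
rewrite (@cycle_down_val (n - k)); try lia.
have := ltn_ord i; case: (ltngtP i.+1 k) => // h; first by rewrite h.
  by case_ifs; lia.
by case_ifs; lia.
Qed.

(** Partial products: in [A l] the first entry of [v] has reached position [l - 1]; in [B l] the
    last entry has moved left to position [l - 1]. *)
Let A l := v \ou (\big[@pmul n/1%g]_(a <- index_iota 1 l) s_ n a).
Let B l := A k \ou (\big[@pmul n/1%g]_(a <- rev (index_iota l n)) s_ n a).

Lemma ell_steps :
  (forall l, 0 < l < k -> ell (A l \ou s_ n l) = (ell (A l)).+1) /\
  (forall l, k <= l < n -> ell (B l.+1 \ou s_ n l) = (ell (B l.+1)).+1).
Proof.
have AS l : 0 < l -> A l.+1 = A l \ou s_ n l.
  by move=> l0; rewrite /A big_nat_recr //= pmulA.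
have BS l : l < n -> B l = B l.+1 \ou s_ n l.
  by move=> ln; rewrite /B big_rev_iotaS // pmulA.
have [|a1 a2] := @slow_steps (fun t => ell (A t.+1)) (k - 1).
  by move=> t tk; rewrite AS // ell_s_le //; lia.
have [|b1 b2] := @slow_steps (fun t => ell (B (n - t))) (n - k).
  move=> t tk; rewrite BS; last by lia.
  have -> : (n - t.+1).+1 = n - t by lia.
  by rewrite ell_s_le //; lia.
have eA1 : A 1 = v by rewrite /A big_geq // pmulu1.
have eBn : B n = A k by rewrite /B /index_iota subnn big_nil pmulu1.
have eBk : B k = w by rewrite hw.
have e1 : (k - 1).+1 = k by lia.
have e2 : n - (n - k) = k by lia.
move: a1 a2 b1 b2; rewrite e1 e2 subn0 eA1 eBn eBk => a1 a2 b1 b2.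
split=> l hl'.
  rewrite -AS; last by lia.
  have -> : l = l.-1.+1 by lia.
  by apply: a2; lia.
rewrite -BS; last by lia.
have -> : l.+1 = n - (n - l.+1) by lia.
have -> : l = n - (n - l.+1).+1 by lia.
have -> : n - (n - (n - (n - l.+1).+1).+1) = n - (n - l.+1) by lia.
by apply: b2; lia.
Qed.

Lemma v0_lt i j : i = 0 :> nat -> 0 < j < k -> v i < v j.
Proof.
move=> i0 jk; have [h _] := ell_steps.
have jk' : j.-1 < n by have := ltn_ord j; lia.
have := ell_s_eq (i := Ordinal jk') (h j jk) _ erefl.
rewrite /= prednK; last by lia.
move=> /(_ erefl); rewrite /A !pmulE.
set a := (X in v X < _); set b := (X in _ < v X).
have -> : a = i.
  apply: val_inj; rewrite /= i0 /a cycle_up_val /=; last by lia.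
  by case_ifs; lia.
have -> // : b = j.
apply: val_inj; rewrite /= /b cycle_up_val /=; last by lia.
by case_ifs; lia.
Qed.

Lemma v_lt_last i j : (k <= i \/ i = 0 :> nat) -> i < j -> j = n.-1 :> nat -> v i < v j.
Proof.
move=> hi ij jn; have [_ h] := ell_steps.
(* The factor [s_ n l] carries the last entry past [v (l - 1)], or past [v 0] when [l = k], since
   the first cycle has put [v 0] there. *)
have [l [lk hli]] : exists l : nat, k <= l < n /\ (i : nat) = if l == k then 0 else l.-1.
  case: hi => hi; last by exists k; rewrite eqxx; lia.
  by exists i.+1; have := ltn_ord j; case: eqP; lia.
have l0 : l.-1 < n by lia.
have ln : l < n by lia.
have := ell_s_eq (i := Ordinal l0) (j := Ordinal ln) (h l lk) _ erefl.
rewrite /= prednK; last by lia.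
move=> /(_ erefl); rewrite /B /A -pmulA !pmulE.
set a := (X in v X < _); set b := (X in _ < v X).
have -> : a = i.
  apply: val_inj; rewrite /= hli /a cycle_up_val; last by lia.
  rewrite (@cycle_down_val (n - l.+1)) /=; try lia.
  by case_ifs; lia.
have -> // : b = j.
apply: val_inj; rewrite /= jn /b cycle_up_val; last by lia.
rewrite (@cycle_down_val (n - l.+1)) /=; try lia.
by case_ifs; lia.
Qed.

End CoxeterWord.

(** * Coatoms *)

Section Coatoms.

Variable n : nat.
Implicit Types (u v w x z : 'S_n) (i j p q : 'I_n).

(* K0 and K1 are the positions k and k+1 of the statement. In terms of prefix
   sums, the second and third clauses say that v is w with the entry w K1 moved
   to the front and the entry w K0 moved to the end. *)
Definition coxeter_pair (v w : 'S_n) (K0 K1 : 'I_n) : Prop :=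
  [/\ K1 = K0.+1 :> nat,
      forall F i, i <= K0 -> pre F v i.+1 + F (w i) = pre F w i.+1 + F (w K1),
      forall F i, K1 <= i -> pre F v i + F (w K0) = pre F w i + F (w i),
      forall i, i <= K0 -> w K1 < w i
    & forall i, K1 <= i -> w i < w K0].

Lemma homo_geq (c : nat) : {homo (fun a : nat => nat_of_bool (c <= a)) : a b / a <= b}.
Proof. by move=> a b ab; lia. Qed.

(** The prefix identities telescope from the one-line form; the two order clauses are the ascents
    met on the way. *)
Lemma coxeter_pairP k (v w : 'S_n) : 1 < k <= n - 2 ->
  w = v \ou (\big[@pmul n/1%g]_(a <- index_iota 1 k) s_ n a)
        \ou (\big[@pmul n/1%g]_(a <- rev (index_iota k n)) s_ n a) ->
  ell w = ell v + (n - 1) ->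
  exists K0 K1 : 'I_n, K1 = k :> nat /\ coxeter_pair v w K0 K1.
Proof.
move=> hk hw hl; have hk' : 0 < k < n by lia.
have h0 : k.-1 < n by lia.
have h1 : k < n by lia.
exists (Ordinal h0), (Ordinal h1); split=> //.
have wv := wE hk' hw hl.
have pre1 F i : i < k ->
    pre F v i.+1 + F (w i) = pre F w i.+1 + F (w (Ordinal h1)).
  case: i => i hi /=; elim: i hi => [|i IH] hi ik.
    rewrite !(preS _ _ (Ordinal hi)) !pre0 /= addnC; congr (F _ + F _).
    have [j [-> hj]] := wv (Ordinal h1); congr (nat_of_ord (v _)).
    by apply: val_inj; rewrite /= hj /=; case_ifs; lia.
  have hi' : i < n by lia.
  rewrite !(preS _ _ (Ordinal hi)) /=.
  have := IH hi' (ltnW ik).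
  have [j [-> hj]] := wv (Ordinal hi').
  have -> : j = Ordinal hi by apply: val_inj; rewrite /= hj /= ik.
  by lia.
split=> //=.
- by lia.
- by move=> F i ik; apply: pre1; lia.
- move=> F [i hi] /=; elim: i hi => [|i IH] hi; first by lia.
  rewrite leq_eqVlt => /orP[/eqP ki|ki].
    have := pre1 F (Ordinal h0); rewrite /= prednK; last by lia.
    have -> : Ordinal hi = Ordinal h1 by apply: val_inj.
    by rewrite -ki; apply; lia.
  have hi' : i < n by lia.
  have := IH hi' ki; rewrite !(preS _ _ (Ordinal hi')) /=.
  have [j [-> hj]] := wv (Ordinal hi).
  have -> : j = Ordinal hi' by apply: val_inj; rewrite /= hj /=; case_ifs; lia.
  by lia.
- move=> i ik; have [j [-> hj]] := wv i.
  have [j0 [-> hj0]] := wv (Ordinal h1).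
  have j00 : j0 = 0 :> nat by rewrite hj0 /=; case_ifs; lia.
  case: (ltngtP i.+1 k) => h; last 2 first; try by lia.
    apply: (v_lt_last hk' hw hl); [by right| |].
      by rewrite j00 hj; case_ifs; lia.
    by rewrite hj; case_ifs; lia.
  apply: (v0_lt hk' hw hl) => //.
  by rewrite hj; case_ifs; lia.
- move=> i ik; have [j [-> hj]] := wv i.
  have [j0 [-> hj0]] := wv (Ordinal h0).
  have j0n : j0 = n.-1 :> nat by rewrite hj0 /=; case_ifs; lia.
  have := ltn_ord i => lin.
  apply: (v_lt_last hk' hw hl) => //.
    by rewrite hj; case_ifs; lia.
  by rewrite j0n hj; case_ifs; lia.
Qed.

Variables (v w : 'S_n) (K0 K1 : 'I_n).
Hypothesis vw : coxeter_pair v w K0 K1.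

Let K10 : K1 = K0.+1 :> nat. Proof. by case: vw. Qed.
Let preL : forall F i, i <= K0 -> pre F v i.+1 + F (w i) = pre F w i.+1 + F (w K1).
Proof. by case: vw. Qed.
Let preR : forall F i, K1 <= i -> pre F v i + F (w K0) = pre F w i + F (w i).
Proof. by case: vw. Qed.
Let wK1 : forall i, i <= K0 -> w K1 < w i. Proof. by case: vw. Qed.
Let wK0 : forall i, K1 <= i -> w i < w K0. Proof. by case: vw. Qed.

Lemma pair_pre_cases (P : nat -> Prop) : P 0 ->
  (forall i, i <= K0 -> P i.+1) -> (forall i, K1 <= i -> P i) ->
  (forall p : nat, n <= p -> P p) -> forall p : nat, P p.
Proof.
move=> P0 PL PR Pn p; case: (leqP n p) => [/Pn //|pn].
case: (leqP K1 p) => [h|h]; first exact: (PR (Ordinal pn)).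
case: p => // p in pn h *.
by apply: (PL (Ordinal (ltnW pn))) => /=; lia.
Qed.

Lemma pair_le : bruhat_le v w.
Proof.
apply: bruhat_criterion; apply: pair_pre_cases => [|i iK|i iK|p pn] q.
- by rewrite !pre0.
- by have := preL (leq q) iK; have := wK1 iK; lia.
- by have := preR (leq q) iK; have := wK0 iK; lia.
- by rewrite !pre_full.
Qed.

(** On each prefix [v] and [w \ou tperm i j] differ from [w] by at most one exchanged entry, so a
    threshold test compares single entries. The decisive thresholds are [w i] on the left and
    [(w j).+1] on the right. *)
Lemma pair_le_tperm i j : i < j -> w j < w i ->
  bruhat_le v (w \ou tperm i j) <->
  (forall q, i <= q < j -> q <= K0 -> w i <= w q) /\
  (forall p, i < p <= j -> K1 <= p -> w p <= w j).
Proof.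
move=> ij wij; split=> [vx|[hL hR]].
  split=> [q iqj qK|p ipj pK].
    have := pre_mono q.+1 (F := leq (w i)) _ vx.
    have := preL (leq (w i)) qK; have := pre_tperm (leq (w i)) w q.+1 ij.
    have -> : i < q.+1 <= j by lia.
    by move=> h1 h2 /(_ (homo_geq _)); lia.
  have := pre_mono p (homo_geq (w j).+1) vx.
  have := preR (leq (w j).+1) pK; have := pre_tperm (leq (w j).+1) w p ij.
  rewrite ipj; lia.
apply: bruhat_criterion => p q.
have lvw r : pre (leq q) v r <= pre (leq q) w r.
  exact: pre_mono (homo_geq q) pair_le.
have := pre_tperm (leq q) w p ij; case: ifP => [ipj|_]; last by have := lvw p; lia.
case: (leqP K1 p) => [Kp|pK].
  have pn : p < n by have := ltn_ord j; lia.
  have := preR (leq q) (i := Ordinal pn) Kp => /=.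
  have := hR (Ordinal pn) ipj Kp.
  have : w i <= w K0.
    case: (leqP K1 i) => [/wK0/ltnW //|iK].
    by apply: hL; lia.
  by lia.
have pn : p.-1 < n by have := ltn_ord j; lia.
have h : p.-1 <= K0 by lia.
have := preL (leq q) (i := Ordinal pn) h => /=; rewrite prednK; last by lia.
have := hL (Ordinal pn) _ h => /=.
have : w K1 <= w j.
  case: (leqP j K0) => [/wK1/ltnW //|jK].
  by apply: hR; lia.
move=> h1 h2 h3; have := h2 ltac:(lia); lia.
Qed.

(** A length drop of one leaves no room for an intermediate element, so only the comparison with [v]
    remains. *)
Lemma pair_coatom i j : i < j -> (ell (w \ou tperm i j)).+1 = ell w ->
  coatom v w (w \ou tperm i j) <->
  (forall q, i <= q < j -> q <= K0 -> w i <= w q) /\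
  (forall p, i < p <= j -> K1 <= p -> w p <= w j).
Proof.
move=> ij E; have [wij _] := (ell_cover w ij).1 E.
rewrite -pair_le_tperm //; split=> [|vx].
  by rewrite /coatom inE => /andP[/andP[]].
have xw : bruhat_le (w \ou tperm i j) w.
  rewrite -{2}[w](pmul_tpermK w i j); apply: bruhat_tperm => //.
  by rewrite !pmulE tpermL tpermR.
have lt_ell y z : bruhat_lt y z -> ell y < ell z.
  by case/andP=> /eqP yz /bruhat_ell[].
rewrite /coatom inE vx xw /= /bruhat_covers /bruhat_lt xw andbT.
apply/andP; split; first by apply/eqP => h; rewrite h in E; lia.
apply/negP => /existsP[y /andP[/lt_ell h1 /lt_ell h2]]; lia.
Qed.

End Coatoms.

(** * Linear inequalities on the interval *)

Section Inequalities.

Variable n : nat.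
Implicit Types (u v w x z : 'S_n) (i j p q e r : 'I_n) (G : {set 'I_n}).

Definition content G z : nat := \sum_(i in G) z i.

Lemma preD F z (a b : nat) : a <= b ->
  pre F z a + \sum_(i < n | a <= i < b) F (z i) = pre F z b.
Proof.
move=> ab; rewrite /pre [RHS](bigID (fun i : 'I_n => i < a)) /=; congr (_ + _);
  by apply: eq_bigl => i; lia.
Qed.

Lemma pre_total z : pre id z n = \sum_(i < n) i.
Proof. exact: pre_full. Qed.

Lemma content_interval G z (a b : nat) : a <= b -> (forall i, (i \in G) = (a <= i < b)) ->
  pre id z a + content G z = pre id z b.
Proof. by move=> ab hG; rewrite -(preD id z ab); congr (_ + _); apply: eq_bigl. Qed.

Lemma content_compl G z : content (~: G) z + content G z = \sum_(i < n) i.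
Proof.
rewrite -(pre_total z) /pre [RHS](bigID (mem G)) /= addnC /content.
by congr (_ + _); apply: eq_bigl => i; rewrite ltn_ord // inE.
Qed.

Lemma content_U G G' z : [disjoint G & G'] -> content (G :|: G') z = content G z + content G' z.
Proof. by move=> GG'; rewrite /content -bigU //=; apply: eq_bigl => i; rewrite !inE. Qed.

Lemma content_U1 G i z : i \notin G -> content (i |: G) z = z i + content G z.
Proof. exact: big_setU1. Qed.

Lemma content_D1 G i z : i \in G -> content G z = z i + content (G :\ i) z.
Proof. exact: big_setD1. Qed.

Lemma content_tperm_stable G z i j : (i \in G) = (j \in G) -> content G (z \ou tperm i j) = content G z.
Proof.
move=> ij; rewrite /content [RHS](reindex_inj (@perm_inj _ (tperm i j))) /=.
apply: eq_big => [p|p _]; last by rewrite pmulE.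
by case: tpermP => // ->.
Qed.

Lemma content_tperm G z i j : i \in G -> j \notin G ->
  content G (z \ou tperm i j) + z i = content G z + z j.
Proof.
move=> iG jG; rewrite !(content_D1 _ iG) pmulE tpermL [z j + _]addnC [z i + _]addnC.
rewrite -!addnA [z j + z i]addnC; congr (_ + _); apply: eq_bigr => p.
rewrite !inE => /andP[pi pG]; rewrite pmulE tpermD //; first by rewrite eq_sym.
by apply: contraNneq jG => ->.
Qed.

(** The subtree at [e] when each position is joined to the nearest smaller entry on its right;
    [up_block] is the subtree for nearest larger entries on the left. *)
Definition low_block w e : {set 'I_n} :=
  [set q : 'I_n | (q <= e) && [forall r : 'I_n, (q <= r < e) ==> (w e < w r)]].

Definition up_block w e : {set 'I_n} :=
  [set q : 'I_n | (e <= q) && [forall r : 'I_n, (e < r <= q) ==> (w r < w e)]].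

Lemma low_blockP w e q :
  reflect (q <= e /\ forall r, q <= r < e -> w e < w r) (q \in low_block w e).
Proof.
rewrite inE; apply: (iffP andP) => -[qe h]; split=> //.
  by move=> r; move/forallP/(_ r)/implyP: h; apply.
by apply/forallP => r; apply/implyP/h.
Qed.

Lemma up_blockP w e q :
  reflect (e <= q /\ forall r, e < r <= q -> w r < w e) (q \in up_block w e).
Proof.
rewrite inE; apply: (iffP andP) => -[qe h]; split=> //.
  by move=> r; move/forallP/(_ r)/implyP: h; apply.
by apply/forallP => r; apply/implyP/h.
Qed.

Lemma low_block_refl w e : e \in low_block w e.
Proof. by apply/low_blockP; split=> // r; lia. Qed.

Lemma up_block_refl w e : e \in up_block w e.
Proof. by apply/up_blockP; split=> // r; lia. Qed.

Lemma low_le w e q : q \in low_block w e -> q <= e.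
Proof. by case/low_blockP. Qed.

Lemma up_ge w e q : q \in up_block w e -> e <= q.
Proof. by case/up_blockP. Qed.

Lemma notin_low w e q : e < q -> (q \in low_block w e) = false.
Proof. by move=> eq; apply/negP => /low_le; lia. Qed.

Lemma notin_up w e q : q < e -> (q \in up_block w e) = false.
Proof. by move=> eq; apply/negP => /up_ge; lia. Qed.

Lemma low_block_interval w e : exists s : 'I_n,
  [/\ s <= e, forall q, (q \in low_block w e) = (s <= q < e.+1),
      forall r, s <= r < e -> w e < w r &
      forall r, r.+1 = s -> w r < w e].
Proof.
have ee : e \in low_block w e by apply/low_blockP; split=> // r; lia.
case: (arg_minnP (@nat_of_ord n) ee) => s /low_blockP[se sr] smin.
exists s; split=> // [q|r rs].
  apply/idP/idP => [qe|/andP[sq qe]]; last by apply/low_blockP; split=> // r; have := sr r; lia.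
  by have /= := smin _ qe; case/low_blockP: qe; lia.
rewrite ltnNge; apply/negP => h; have re : r != e by rewrite -val_eqE /=; lia.
have := perm_neq w re => wre.
suff /smin /= : r \in low_block w e by lia.
apply/low_blockP; split; first by lia.
move=> q rq; have := sr q; have [->|qr] := eqVneq q r; first by lia.
by move: qr; rewrite -val_eqE /=; lia.
Qed.

Lemma up_block_interval w e : exists t : 'I_n,
  [/\ e <= t, forall q, (q \in up_block w e) = (e <= q < t.+1),
      forall r, e < r <= t -> w r < w e &
      forall r, r = t.+1 :> nat -> w e < w r].
Proof.
have ee : e \in up_block w e by apply/up_blockP; split=> // r; lia.
case: (arg_maxnP (@nat_of_ord n) ee) => t /up_blockP[te tr] tmax.
exists t; split=> // [q|r rs].
  apply/idP/idP => [qe|/andP[sq qe]]; last by apply/up_blockP; split=> // r; have := tr r; lia.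
  by have /= := tmax _ qe; case/up_blockP: qe; lia.
rewrite ltnNge; apply/negP => h; have re : r != e by rewrite -val_eqE /=; lia.
have := perm_neq w re => wre.
suff /tmax /= : r \in up_block w e by lia.
apply/up_blockP; split; first by lia.
move=> q rq; have := tr q; have [->|qr] := eqVneq q r; first by lia.
by move: qr; rewrite -val_eqE /=; lia.
Qed.

Variables (v w : 'S_n) (K0 K1 : 'I_n).
Hypothesis vw : coxeter_pair v w K0 K1.

Let K10 : K1 = K0.+1 :> nat. Proof. by case: vw. Qed.
Let preL : forall F i, i <= K0 -> pre F v i.+1 + F (w i) = pre F w i.+1 + F (w K1).
Proof. by case: vw. Qed.
Let preR : forall F i, K1 <= i -> pre F v i + F (w K0) = pre F w i + F (w i).
Proof. by case: vw. Qed.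
Let wK1 : forall i, i <= K0 -> w K1 < w i. Proof. by case: vw. Qed.
Let wK0 : forall i, K1 <= i -> w i < w K0. Proof. by case: vw. Qed.

Variable z : 'S_n.
Hypothesis vz : bruhat_le v z.
Hypothesis zw : bruhat_le z w.

(* Prefix sums of any monotone function of the entries increase along Bruhat
   order; truncating at c makes them comparable over an interval. *)
Lemma interval_upper (a b c : nat) : a <= b ->
  pre (subn^~ c) w a <= pre (subn^~ c) v a ->
  \sum_(i < n | a <= i < b) z i <= \sum_(i < n | a <= i < b) (c + (w i - c)).
Proof.
move=> ab wva; have hF : {homo subn^~ c : x y / x <= y} by move=> x y; lia.
apply: (@leq_trans (\sum_(i < n | a <= i < b) (c + (z i - c)))).
  by apply: leq_sum => i _; lia.
rewrite !big_split /= leq_add2l.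
have := preD (subn^~ c) z ab; have := preD (subn^~ c) w ab => /=.
have := pre_mono a hF vz; have := pre_mono b hF zw; lia.
Qed.

Lemma interval_lower (a b c : nat) : a <= b ->
  pre (minn^~ c) w b <= pre (minn^~ c) v b ->
  \sum_(i < n | a <= i < b) minn (w i) c <= \sum_(i < n | a <= i < b) minn (z i) c.
Proof.
move=> ab wvb; have hF : {homo minn^~ c : x y / x <= y} by move=> x y; lia.
have := preD (minn^~ c) z ab; have := preD (minn^~ c) w ab => /=.
have := pre_mono b hF vz; have := pre_mono a hF zw; lia.
Qed.

(** Truncation at [w e] is exact on the block, whose entries in [w] are at least [w e]. At its left
    end the prefixes of [v] and [w] differ by two entries below [w e], so their excesses over [w e]
    agree. *)
Lemma low_block_le e : e <= K0 -> content (low_block w e) z <= content (low_block w e) w.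
Proof.
move=> eK; have [s [se sE sr s1]] := low_block_interval w e.
have XE y : content (low_block w e) y = \sum_(i < n | s <= i < e.+1) y i by apply: eq_bigl.
rewrite !XE; have se' : s <= e.+1 by lia.
apply: leq_trans (interval_upper (c := w e) se' _) _.
  have mc := wK1 eK; case: (posnP s) => [->|s0]; first by rewrite !pre0.
  have sn : s.-1 < n by have := ltn_ord s; lia.
  have := @preL (subn^~ (w e)) (Ordinal sn); rewrite /= prednK // => h.
  have := s1 (Ordinal sn); rewrite /= prednK // => /(_ erefl).
  by have := h ltac:(lia); lia.
apply: leq_sum => i; have := sr i; have [->|] := eqVneq i e; first by lia.
by rewrite -val_eqE /=; lia.
Qed.

Lemma up_block_ge e : K1 <= e -> content (up_block w e) w <= content (up_block w e) z.
Proof.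
move=> eK; have [t [te tE tr t1]] := up_block_interval w e.
have XE y : content (up_block w e) y = \sum_(i < n | e <= i < t.+1) y i by apply: eq_bigl.
rewrite !XE; have te' : e <= t.+1 by lia.
apply: (@leq_trans (\sum_(i < n | e <= i < t.+1) minn (w i) (w e))).
  apply: leq_sum => i; have := tr i; have [->|] := eqVneq i e; first by lia.
  by rewrite -val_eqE /=; lia.
apply: leq_trans (interval_lower (c := w e) te' _) _; last first.
  by apply: leq_sum => i _; lia.
have mc := wK0 eK; case: (leqP n t.+1) => [tn|tn]; first by rewrite !pre_full.
have := @preR (minn^~ (w e)) (Ordinal tn) => /= h.
have := t1 (Ordinal tn) erefl.
by have := h ltac:(lia); lia.
Qed.

Lemma sum_interval_recl (F : 'I_n -> nat) i (b : nat) : i < b ->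
  \sum_(p < n | i <= p < b) F p = F i + \sum_(p < n | i < p < b) F p.
Proof.
move=> ib; rewrite (bigD1 i) /=; last by rewrite leqnn.
by congr (_ + _); apply: eq_bigl => p; rewrite -val_eqE /=; lia.
Qed.

Lemma sum_interval_recr (F : 'I_n -> nat) j (a : nat) : a <= j ->
  \sum_(p < n | a <= p < j.+1) F p = \sum_(p < n | a <= p < j) F p + F j.
Proof.
move=> aj; rewrite (bigD1 j) /= 1?addnC; last by lia.
by congr (_ + _); apply: eq_bigl => p; rewrite -val_eqE /=; lia.
Qed.

(** On [(e, b]] the only entry of [w] below the threshold [w e] is [w b]; lifting it to [w e] gives
    the sum over [[e, b)]. *)
Lemma low_edge_le e (b : 'I_n) : e < b -> b <= K0 -> w b < w e ->
  (forall p, e < p < b -> w e < w p) ->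
  \sum_(p < n | e < p < b.+1) z p <= \sum_(p < n | e <= p < b) w p.
Proof.
move=> eb bK wbe h; have eK : e <= K0 by lia.
have mc := wK1 eK; have := preL (subn^~ (w e)) eK => /= hp.
apply: leq_trans (interval_upper (c := w e) _ _) _; [by lia|by lia|].
rewrite sum_interval_recr ?sum_interval_recl //=.
rewrite addnC leq_add //; first by lia.
by apply: leq_sum => p /h; lia.
Qed.

Lemma up_edge_ge e (a : 'I_n) : a < e -> K1 <= a -> w e < w a ->
  (forall p, a < p < e -> w p < w e) ->
  \sum_(p < n | a < p < e.+1) w p <= \sum_(p < n | a <= p < e) z p.
Proof.
move=> ae aK wea h; have eK : K1 <= e by lia.
have mc := wK0 eK; have := preR (minn^~ (w e)) eK => /= hp.
apply: (@leq_trans (\sum_(p < n | a <= p < e) minn (w p) (w e))); last first.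
  apply: leq_trans (interval_lower (c := w e) _ _) _; [by lia|by lia|].
  by apply: leq_sum => i _; lia.
rewrite sum_interval_recr ?sum_interval_recl //=.
rewrite addnC leq_add //; first by lia.
by apply: leq_sum => p /h; lia.
Qed.

Lemma pre_id_ge (p : nat) : pre id v p <= pre id z p.
Proof. exact: pre_mono. Qed.

(* Truncation at a value c between the entries w (s - 1) and w (t + 1) next to
   the two blocks; such a c exists because these entries form no descent. *)
Lemma mid_block_le (s t : 'I_n) :
  (forall q, (q \in low_block w K0) = (s <= q < K0.+1)) -> s <= K0 ->
  (forall p, p.+1 = s -> w p < w K0) ->
  (forall q, (q \in up_block w K1) = (K1 <= q < t.+1)) -> K1 <= t ->
  (forall q, q = t.+1 :> nat -> w K1 < w q) ->
  (forall p q, p.+1 = s -> q = t.+1 :> nat -> w p < w q) ->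
  content (low_block w K0) z + \sum_(p < n | t < p) z p <=
  content (low_block w K0) w + \sum_(p < n | t < p) w p.
Proof.
move=> sE sK s1 tE tK t1 st.
have [c [mc cM sc ct]] : exists c : nat, [/\ w K1 <= c, c <= w K0,
    forall p, p.+1 = s -> w p <= c & forall q, q = t.+1 :> nat -> c <= w q].
  case: (posnP s) => [s0|s0].
    exists (w K1); split=> // [|p|q /t1/ltnW //]; first exact/ltnW/wK1.
    by rewrite s0.
  have sn : s.-1 < n by have := ltn_ord s; lia.
  have sS : (Ordinal sn).+1 = s by rewrite /= prednK.
  exists (w (Ordinal sn)); split=> [||p ps|q /(st _ _ sS)/ltnW //].
  - by apply/ltnW/wK1 => /=; lia.
  - exact/ltnW/s1.
  - suff -> : p = Ordinal sn by [].
    by apply: val_inj => /=; lia.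
have sK1 : s <= K0.+1 by lia.
have XE y : pre id y s + content (low_block w K0) y = pre id y K0.+1.
  exact: content_interval.
have tailE y : pre id y t.+1 + \sum_(p < n | t < p) y p = \sum_(i < n) i.
  rewrite -(pre_total y) -(preD id y (ltn_ord t)); congr (_ + _).
  by apply: eq_bigl => i; rewrite ltn_ord andbT.
(* Each content is cut at [c] into an excess and a truncated part. The prefix of length [s] controls
   the excess, that of length [t + 1] the truncated part; in [w] the lower block lies above [c] and
   the upper block below it. *)
have splitE y (p : nat) : pre id y p = pre (subn^~ c) y p + pre (minn^~ c) y p.
  by rewrite /pre -big_split /=; apply: eq_bigr => i _; lia.
have hF : {homo subn^~ c : x y / x <= y} by move=> x y; lia.
have hG : {homo minn^~ c : x y / x <= y} by move=> x y; lia.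
have f1 : pre (subn^~ c) w s <= pre (subn^~ c) z s.
  apply: leq_trans (pre_mono s hF vz).
  case: (posnP s) => [->|s0]; first by rewrite !pre0.
  have sn : s.-1 < n by have := ltn_ord s; lia.
  have := @preL (subn^~ c) (Ordinal sn); rewrite /= prednK // => h.
  have := sc (Ordinal sn); rewrite /= prednK // => /(_ erefl).
  by have := h ltac:(lia); lia.
have KT : K0.+1 <= t.+1 by lia.
have f2 := preD (subn^~ c) z KT; have f2' := preD (subn^~ c) w KT.
have f2'' : \sum_(i < n | K0.+1 <= i < t.+1) (w i - c) = 0.
  apply: big1 => i; rewrite -K10 -tE => /up_blockP[Ki h].
  by have := h i; have [->|] := eqVneq i K1; [lia|rewrite -val_eqE /=; lia].
have f3 : pre (minn^~ c) w t.+1 <= pre (minn^~ c) z t.+1.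
  apply: leq_trans (pre_mono _ hG vz).
  case: (leqP n t.+1) => [tn|tn]; first by rewrite !pre_full.
  have := @preR (minn^~ c) (Ordinal tn) => /= h.
  have := ct (Ordinal tn) erefl; have := h ltac:(lia); lia.
have f4 := preD (minn^~ c) z sK1; have f4' := preD (minn^~ c) w sK1.
have f4'' : \sum_(i < n | s <= i < K0.+1) minn (z i) c <=
            \sum_(i < n | s <= i < K0.+1) minn (w i) c.
  apply: leq_sum => i; rewrite -sE => /low_blockP[iK h].
  by have := h i; have [->|] := eqVneq i K0; [lia|rewrite -val_eqE /=; lia].
have := XE z; have := XE w; have := tailE z; have := tailE w.
by rewrite !splitE; move: f1 f2 f2' f2'' f3 f4 f4' f4'' => /=; lia.
Qed.

End Inequalities.

(** * Sequences of optional transpositions *)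

Section SwapProcess.

Variables (n : nat) (T : finType) (w : 'S_n) (a b : T -> 'I_n) (key : T -> nat).
Variables (I J : T -> {set 'I_n}).
Implicit Types (S : {set T}) (e f : T) (i j : 'I_n) (t : nat).

Hypothesis key_inj : injective key.

(** The key of an edge is the time of its exchange; times that carry no selected edge change
    nothing, so keys need not be consecutive. *)
Fixpoint run S t : 'S_n :=
  if t is t'.+1 then
    if [pick e | (key e == t') && (e \in S)] is Some e
    then run S t' \ou tperm (a e) (b e) else run S t'
  else w.

Lemma run_in S e : e \in S -> run S (key e).+1 = run S (key e) \ou tperm (a e) (b e).
Proof.
move=> eS /=; case: pickP => [f /andP[/eqP/key_inj-> //]|/(_ e)].
by rewrite eqxx eS.
Qed.

Lemma run_out S e : e \notin S -> run S (key e).+1 = run S (key e).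
Proof.
move=> eS /=; case: pickP => [f /andP[/eqP/key_inj->]|//].
by rewrite (negPf eS).
Qed.

Lemma run_step S t : run S t.+1 = run S t \/
  exists2 e, key e = t /\ e \in S & run S t.+1 = run S t \ou tperm (a e) (b e).
Proof.
rewrite /=; case: pickP => [e /andP[/eqP et eS]|_]; last by left.
by right; exists e.
Qed.

Lemma run_ind (P : nat -> 'S_n -> Prop) S : P 0 w ->
  (forall t y, (forall e, key e != t) -> P t y -> P t.+1 y) ->
  (forall e y, e \notin S -> P (key e) y -> P (key e).+1 y) ->
  (forall e y, e \in S -> P (key e) y -> P (key e).+1 (y \ou tperm (a e) (b e))) ->
  forall t, P t (run S t).
Proof.
move=> P0 Pno Pout Pin; elim=> // t IH.
have [e /eqP et|no] := pickP (fun e => key e == t).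
  move: IH; rewrite -et; have [eS|eS] := boolP (e \in S).
    by rewrite run_in //; apply: Pin.
  by rewrite run_out //; apply: Pout.
have -> : run S t.+1 = run S t by case: (run_step S t) => // -[e [et _]]; have := no e; rewrite et eqxx.
by apply: Pno IH => e; rewrite no.
Qed.

Lemma run_stable (G : {set 'I_n}) S t1 t2 : t1 <= t2 ->
  (forall e, t1 <= key e < t2 -> (a e \in G) = (b e \in G)) ->
  content G (run S t2) = content G (run S t1).
Proof.
move=> t12; rewrite -(subnKC t12); elim: (t2 - t1) => [|d IH] h; first by rewrite addn0.
rewrite addnS; have [->|[e [et _] ->]] := run_step S (t1 + d).
  by apply: IH => e he; apply: h; lia.
rewrite content_tperm_stable; last by apply: h; lia.
by apply: IH => f hf; apply: h; lia.
Qed.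

Lemma run_agree S S' t : (forall e, key e < t -> (e \in S) = (e \in S')) ->
  run S t = run S' t.
Proof.
elim: t => // t IH h; have E : run S t = run S' t by apply: IH => e et; apply: h; lia.
have [e /eqP et|no] := pickP (fun e => key e == t).
  move: E; rewrite -et => E; have eS := h e; rewrite -et ltnSn in eS.
  have [eS'|eS'] := boolP (e \in S'); first by rewrite !run_in ?eS ?E.
  by rewrite !run_out ?eS ?E.
by rewrite /= !E; case: pickP => [e /andP[]|_]; rewrite ?no //; case: pickP => [e /andP[]|//]; rewrite no.
Qed.

(* The exchange at e carries J e to J' e: whatever the choices made before e,
   the content of J e reaches that of J' e at w exactly when e is used. *)
Definition J' e : {set 'I_n} := a e |: (J e :\ b e).

(** The cut [I e] is crossed by [e] alone, so its content records whether [e] was used. [IJ_lt]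
    keeps the places of the two ends in order under the later exchanges. *)
Hypothesis I_ends : forall e, a e \in I e /\ b e \notin I e.
Hypothesis J_ends : forall e, a e \notin J e /\ b e \in J e.
Hypothesis I_cross : forall e f, f != e -> (a f \in I e) = (b f \in I e).
Hypothesis J_later : forall e f, key e < key f -> (a f \in J e) = (b f \in J e).
Hypothesis J_earlier : forall e f, key f < key e -> (a f \in J' e) = (b f \in J' e).
Hypothesis IJ_lt : forall e i j, i \in I e :\: J e -> j \in J e :\: I e -> i < j.
Hypothesis descent : forall S e, run S (key e) (b e) < run S (key e) (a e).

Definition final S := run S (\max_e key e).+1.

Let key_max e : key e < (\max_e key e).+1.
Proof. by rewrite ltnS; apply: leq_bigmax. Qed.

Definition fall S e : nat := run S (key e) (a e) - run S (key e) (b e).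

Lemma fall_gt0 S e : 0 < fall S e.
Proof. by rewrite subn_gt0. Qed.

Lemma content_J' e z : content (J' e) z + z (b e) = content (J e) z + z (a e).
Proof.
have [aJ bJ] := J_ends e; rewrite content_U1; last by rewrite !inE negb_and aJ orbT.
by rewrite (content_D1 _ bJ); lia.
Qed.

Lemma final_I S e : content (I e) (final S) + (e \in S) * fall S e = content (I e) w.
Proof.
have [aI bI] := I_ends e; rewrite /final.
rewrite (@run_stable _ _ (key e).+1) //; last first.
  by move=> f hf; apply: I_cross; apply: contraTneq hf => ->; lia.
rewrite -(@run_stable (I e) S 0 (key e)) //; last first.
  by move=> f hf; apply: I_cross; apply: contraTneq hf => ->; lia.
have [eS|eS] := boolP (e \in S); last by rewrite run_out // mul0n addn0.
rewrite run_in // mul1n; have := content_tperm (run S (key e)) aI bI.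
by have := descent S e; rewrite /fall; lia.
Qed.

Lemma final_J S e : content (J e) (final S) + (e \notin S) * fall S e = content (J' e) w.
Proof.
have [aJ bJ] := J_ends e; rewrite /final.
rewrite (@run_stable _ _ (key e).+1) //; last first.
  by move=> f /andP[hf _]; apply: J_later.
rewrite -(@run_stable (J' e) S 0 (key e)) //; last first.
  by move=> f /andP[_ hf]; apply: J_earlier.
have := content_J' e (run S (key e)); have := descent S e.
have [eS|eS] := boolP (e \in S); last by rewrite run_out // mul1n /fall; lia.
rewrite run_in // mul0n addn0 tpermC; have := content_tperm (run S (key e)) bJ aJ.
by lia.
Qed.

Lemma final0 : final finset.set0 = w.
Proof.
rewrite /final; elim: (_.+1) => // t IH.
by case: (run_step finset.set0 t) => [->//|[e [_]]]; rewrite inE.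
Qed.

(** The later exchanges form a common right factor [pi] that preserves [I e] and [J e]. The places
    that [pi] sends to the ends of [e] therefore lie in [I e :\: J e] and [J e :\: I e], and the two
    products differ by transposing them. *)
Lemma final_add S e : e \notin S -> bruhat_le (final (e |: S)) (final S).
Proof.
move=> eS; set y := run S (key e); set tt := tperm (a e) (b e).
have [aI bI] := I_ends e; have [aJ bJ] := J_ends e.
have ye : run (e |: S) (key e) = y.
  by apply: run_agree => f fe; rewrite !inE; case: eqP fe => // ->; rewrite ltnn.
have [pi [fE fE' piI piJ]] : exists pi : 'S_n,
    [/\ final S = y \ou pi, final (e |: S) = y \ou tt \ou pi,
        forall i, (pi i \in I e) = (i \in I e) & forall i, (pi i \in J e) = (i \in J e)].
  rewrite /final -(subnKC (key_max e)); elim: (_ - _) => [|d [pi [fE fE' piI piJ]]].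
    exists 1%g; rewrite addn0 run_out // run_in ?setU11 // ye !pmulu1.
    by split=> // i; rewrite perm1.
  rewrite addnS; have [f /eqP fd|no] := pickP (fun f => key f == (key e).+1 + d); last first.
    have stay S' : run S' ((key e).+1 + d).+1 = run S' ((key e).+1 + d).
      by case: (run_step S' ((key e).+1 + d)) => // -[f [fd _]]; have := no f; rewrite fd eqxx.
    by exists pi; rewrite !stay.
  move: fE fE'; rewrite -fd => fE fE'.
  have fe : f != e by apply: contra_eq_neq fd => ->; lia.
  have [fS|fS] := boolP (f \in S); last first.
    by exists pi; rewrite !run_out ?inE ?negb_or ?fe.
  exists (pi \ou tperm (a f) (b f)); rewrite !run_in ?inE ?fS ?orbT // fE fE' !pmulA.
  split=> // i; rewrite pmulE ?piI ?piJ; case: tpermP => // ->.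
  - exact/esym/I_cross.
  - exact: I_cross.
  - by apply/esym/J_later; lia.
  - by apply/J_later; lia.
have pA : pi ((pi^-1)%g (a e)) = a e by rewrite permKV.
have pB : pi ((pi^-1)%g (b e)) = b e by rewrite permKV.
set a' := (pi^-1)%g (a e) in pA; set b' := (pi^-1)%g (b e) in pB.
have ab' : a' < b'.
  by apply: (@IJ_lt e); rewrite !inE -piI -piJ ?pA ?pB ?aI ?bI ?aJ ?bJ.
have -> : final S = final (e |: S) \ou tperm a' b'.
  rewrite fE fE'; apply/permP => i; rewrite !pmulE (inj_tperm _ _ _ (@perm_inj _ pi)) pA pB.
  by rewrite tpermK.
apply: bruhat_tperm => //; rewrite fE' !pmulE pA pB tpermL tpermR.
exact: descent.
Qed.

Lemma final_anti S S' : S \subset S' -> bruhat_le (final S') (final S).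
Proof.
have [m] := ubnP #|S' :\: S|; elim: m S => // m IH S Sm SS'.
have [SS|/subsetPn[e eS' eS]] := boolP (S' \subset S).
  by have -> : S = S'; [apply/eqP; rewrite finset.eqEsubset SS'|exact: bruhat_refl].
apply: bruhat_trans (final_add eS); apply: IH; last by rewrite finset.subUset finset.sub1set eS'.
rewrite -ltnS; apply: leq_trans Sm; rewrite ltnS; apply: proper_card.
apply/properP; split; first by apply/finset.setDS/finset.subsetUr.
by exists e; rewrite !inE ?eS ?eS' ?eqxx.
Qed.

End SwapProcess.

(** * The spanning tree at w *)

Section Tree.

Variables (n : nat) (v w : 'S_n) (K0 K1 : 'I_n).
Implicit Types (u x y z : 'S_n) (i j p q e f r : 'I_n) (t : nat).
Hypothesis vw : coxeter_pair v w K0 K1.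

Let K10 : K1 = K0.+1 :> nat. Proof. by case: vw. Qed.
Let wK1 : forall i, i <= K0 -> w K1 < w i. Proof. by case: vw. Qed.
Let wK0 : forall i, K1 <= i -> w i < w K0. Proof. by case: vw. Qed.
Let wcong p q : p = q :> nat -> w p = w q :> nat.
Proof. by move=> /val_inj->. Qed.
Let neqN p q : p != q -> p <> q :> nat.
Proof. by move/eqP=> pq /val_inj. Qed.

(** For [e <= K0] the default [K1] is itself a candidate, because [w K1] is below every entry up to
    [K0]. Likewise [K0] for [prev_larger] when [K1 <= e]. *)
Definition next_smaller e : 'I_n := [arg min_(q < K1 | (e < q) && (w q < w e)) q].
Definition prev_larger e : 'I_n := [arg max_(q > K0 | (q < e) && (w e < w q)) q].

Lemma next_smallerP e : e <= K0 ->
  [/\ e < next_smaller e, next_smaller e <= K1, w (next_smaller e) < w e &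
      forall p, e < p < next_smaller e -> w e < w p].
Proof.
move=> eK; have K1P : (e < K1) && (w K1 < w e) by rewrite (wK1 eK) K10 ltnS eK.
rewrite /next_smaller; case: arg_minnP => // b /andP[eb wbe] bmin.
split=> // [|p /andP[ep pb]]; first exact: bmin.
have pe : p != e by rewrite -val_eqE /=; lia.
have := perm_neq w pe; have := bmin p; rewrite ep /=; lia.
Qed.

Lemma prev_largerP e : K1 <= e ->
  [/\ prev_larger e < e, K0 <= prev_larger e, w e < w (prev_larger e) &
      forall p, prev_larger e < p < e -> w p < w e].
Proof.
move=> eK; have K0P : (K0 < e) && (w e < w K0) by rewrite (wK0 eK) -K10 eK.
rewrite /prev_larger; case: arg_maxnP => // a /andP[ae wae] amax.
split=> // [|p /andP[ap pe]]; first exact: amax.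
have ep : p != e by rewrite -val_eqE /=; lia.
have := perm_neq w ep; have := amax p; rewrite pe /=; lia.
Qed.

(** Edges are indexed by the positions other than [K1], each naming the edge to its parent; [K0]
    names the common edge. [edge_a] is the left end. *)
Definition edge_a e : 'I_n := if e <= K0 then e else prev_larger e.
Definition edge_b e : 'I_n := if e <= K0 then next_smaller e else e.

(* Parents come before children and inner siblings last, and the edge (K0, K1)
   comes after the other edges at K0 and K1 and before their subtrees. *)
Definition edge_key e : nat :=
  if e <= K0 then n + w e else if w K1 < w e then n - w e else 3 * n - w e.

(* The side of edge e in the tree: no other edge crosses it. *)
Definition edge_I e : {set 'I_n} :=
  if e < K0 then low_block w e
  else if e == K0 then low_block w K0 :|: [set q : 'I_n | (K1 <= q) && (q \notin up_block w K1)]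
  else ~: up_block w e.

(* Crossed only by edges that come before e. *)
Definition edge_J e : {set 'I_n} :=
  if e <= K0 then [set q : 'I_n | (e < q) && ((next_smaller e == K1) || (q <= next_smaller e))]
  else [set q : 'I_n | ~~ ((q < e) && ((prev_larger e == K0) || (prev_larger e <= q)))].

Lemma edge_cases (P : 'I_n -> Prop) :
  (forall e, e <= K0 -> P e) -> (forall e, K1 < e -> P e) -> forall e, e != K1 -> P e.
Proof.
move=> PL PR e eK; case: (leqP e K0) => [|Ke]; first exact: PL.
by apply: PR; move: eK; rewrite -val_eqE /=; lia.
Qed.

Lemma edge_aL e : e <= K0 -> edge_a e = e.
Proof. by rewrite /edge_a => ->. Qed.

Lemma edge_bL e : e <= K0 -> edge_b e = next_smaller e.
Proof. by rewrite /edge_b => ->. Qed.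

Lemma leK0F e : K1 < e -> (e <= K0) = false.
Proof. by move=> eK; apply/negbTE; rewrite -ltnNge -K10 ltnW. Qed.

Lemma edge_aR e : K1 < e -> edge_a e = prev_larger e.
Proof. by rewrite /edge_a => /leK0F->. Qed.

Lemma edge_bR e : K1 < e -> edge_b e = e.
Proof. by rewrite /edge_b => /leK0F->. Qed.

(** The three branches take values below [n], in [[n, 2n)] and above [2n], each strictly monotone in
    the entry. *)
Lemma edge_key_inj e f : e != K1 -> f != K1 -> edge_key e = edge_key f -> e = f.
Proof.
move=> eK fK E; apply: (@perm_inj _ w); apply: val_inj; move: E => /=.
have := ltn_ord (w e); have := ltn_ord (w f); have := ltn_ord (w K1).
rewrite /edge_key; case: ifP => eK'; case: ifP => fK'; do ?[case: ifP => ?]; lia.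
Qed.

(** A subtree is left only through the edge from its root to the parent. *)
Lemma low_block_edge e f : e <= K0 -> f <= K0 -> f != e ->
  (f \in low_block w e) = (next_smaller f \in low_block w e).
Proof.
move=> eK fK /neqN fe; have [s [se sE sr s1]] := low_block_interval w e.
have [h1 h2 h3 h4] := next_smallerP fK; rewrite !sE.
have g1 := sr f; have g2 := sr (next_smaller f); have g3 := h4 e.
have c1 := @wcong (next_smaller f) e.
have [fs|fs] := leqP s f; first by lia.
have sn : s.-1 < n by have := ltn_ord s; lia.
have := s1 (Ordinal sn); have := h4 (Ordinal sn); have := @wcong f (Ordinal sn).
rewrite /= prednK; last by lia.
by move=> k1 k2 /(_ erefl) k3; lia.
Qed.

Lemma up_block_edge e f : K1 <= e -> K1 < f -> f != e ->
  (f \in up_block w e) = (prev_larger f \in up_block w e).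
Proof.
move=> eK fK /neqN fe; have [t [te tE tr t1]] := up_block_interval w e.
have [h1 h2 h3 h4] := prev_largerP (ltnW fK); rewrite !tE.
have g1 := tr f; have g2 := tr (prev_larger f); have g3 := h4 e.
have c1 := @wcong (prev_larger f) e.
have [ft|ft] := leqP f t; first by lia.
have tn : t.+1 < n by have := ltn_ord f; lia.
have := t1 (Ordinal tn) erefl; have := h4 (Ordinal tn); have := @wcong f (Ordinal tn).
by move=> /= k1 k2 k3; lia.
Qed.

Lemma edge_I_low e q : e < K0 -> (q \in edge_I e) = (q \in low_block w e).
Proof. by rewrite /edge_I => ->. Qed.

Lemma edge_I_mid q : (q \in edge_I K0) =
  (q \in low_block w K0) || (K1 <= q) && (q \notin up_block w K1).
Proof. by rewrite /edge_I ltnn eqxx finset.in_setU; congr (_ || _); rewrite inE. Qed.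

Lemma edge_I_up e q : K1 < e -> (q \in edge_I e) = (q \notin up_block w e).
Proof.
move=> eK; rewrite /edge_I -val_eqE /=.
have -> : (e < K0) = false by lia.
have -> : (e == K0 :> nat) = false by lia.
by rewrite finset.in_setC.
Qed.

Lemma edge_K0P e : ~ e < K0 -> e <= K0 -> e = K0.
Proof. by move=> h1 h2; apply: val_inj => /=; lia. Qed.

(** For the common edge: right positions outside [up_block w K1] reach [K0] without passing [K1],
    and left positions outside [low_block w K0] stay on the side of [K1]. *)
Lemma edge_I_cross e f : e != K1 -> f != K1 -> f != e ->
  (edge_a f \in edge_I e) = (edge_b f \in edge_I e).
Proof.
elim/edge_cases: e / => e eK; elim/edge_cases: f / => f fK fe.
- have [h1 h2 h3 h4] := next_smallerP fK; rewrite edge_aL ?edge_bL //.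
  have [eK0|/negP eK0] := boolP (e < K0); first by rewrite !edge_I_low // low_block_edge.
  rewrite (edge_K0P eK0 eK) in fe *; rewrite !edge_I_mid -(low_block_edge _ fK) //.
  have -> : (K1 <= f) = false by lia.
  have [k|k] := leqP K1 (next_smaller f); last by [].
  have -> : next_smaller f = K1 by apply: val_inj => /=; lia.
  by rewrite up_block_refl.
- have [h1 h2 h3 h4] := prev_largerP (ltnW fK); rewrite edge_aR ?edge_bR //.
  have [eK0|/negP eK0] := boolP (e < K0).
    by rewrite !edge_I_low // !notin_low //; lia.
  rewrite (edge_K0P eK0 eK) !edge_I_mid.
  have fK1 : f != K1 by rewrite -val_eqE /=; lia.
  rewrite -(up_block_edge (leqnn K1) fK fK1) (notin_low w (q := f)); last by lia.
  have [k|k] := leqP K1 (prev_larger f).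
    by rewrite notin_low ?(ltnW fK) //; lia.
  have kE : prev_larger f = K0 by apply: val_inj => /=; lia.
  by rewrite kE low_block_refl (up_block_edge (leqnn K1) fK fK1) kE notin_up ?(ltnW fK) // K10.
- have [h1 h2 h3 h4] := next_smallerP fK.
  by rewrite edge_aL ?edge_bL // !edge_I_up // !notin_up //; lia.
- by rewrite edge_aR ?edge_bR // !edge_I_up // -up_block_edge // ltnW.
Qed.

Lemma edge_I_ends e : e != K1 -> edge_a e \in edge_I e /\ edge_b e \notin edge_I e.
Proof.
elim/edge_cases: e / => e eK.
- have [h1 h2 h3 h4] := next_smallerP eK; rewrite edge_aL ?edge_bL //.
  have [eK0|/negP eK0] := boolP (e < K0).
    by rewrite !edge_I_low // low_block_refl notin_low.
  have eE := edge_K0P eK0 eK.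
  have kE : next_smaller e = K1 by apply: val_inj => /=; rewrite eE in h1 h2 *; lia.
  rewrite kE eE; split; first by rewrite edge_I_mid low_block_refl.
  by rewrite edge_I_mid up_block_refl andbF orbF notin_low // K10.
- have [h1 h2 h3 h4] := prev_largerP (ltnW eK); rewrite edge_aR ?edge_bR //.
  by rewrite !edge_I_up // up_block_refl notin_up.
Qed.

Lemma edge_J_ends e : e != K1 -> edge_a e \notin edge_J e /\ edge_b e \in edge_J e.
Proof.
elim/edge_cases: e / => e eK; rewrite /edge_a /edge_b /edge_J.
  by have [h1 h2 h3 h4] := next_smallerP eK; rewrite eK !inE ltnn h1 leqnn orbT.
have [h1 h2 h3 h4] := prev_largerP (ltnW eK).
have -> : (e <= K0) = false by lia.
by rewrite !inE ltnn h1 leqnn orbT.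
Qed.

Lemma edge_IJ_lt e i j : e != K1 ->
  i \in edge_I e :\: edge_J e -> j \in edge_J e :\: edge_I e -> i < j.
Proof.
elim/edge_cases: e / => e eK; rewrite !finset.in_setD /edge_J ?eK.
- have [h1 h2 h3 h4] := next_smallerP eK; rewrite !inE.
  have [eK0|/negP eK0] := boolP (e < K0).
    by rewrite !edge_I_low // => /andP[_ /low_le] + /andP[_ /andP[+ _]]; lia.
  have eE := edge_K0P eK0 eK.
  have nE : next_smaller e == K1 by rewrite -val_eqE /=; rewrite eE in h1 h2 *; lia.
  rewrite nE eE edge_I_mid /= !andbT -leqNgt => /andP[iK _] /andP[_]; lia.
- rewrite (_ : (e <= K0) = false) ?inE ?edge_I_up //; last by lia.
  by rewrite !negbK => /andP[+ _] /andP[/up_ge + _]; lia.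
Qed.

(** An edge can cross a boundary of [edge_J e] only if its entry compares with those at [e] and its
    parent in the way that gives it an earlier key. *)
Lemma edge_J_later e f : e != K1 -> f != K1 -> edge_key e < edge_key f ->
  (edge_a f \in edge_J e) = (edge_b f \in edge_J e).
Proof.
have wKn := ltn_ord (w K1).
elim/edge_cases: e / => e eK; elim/edge_cases: f / => f fK;
  have wen := ltn_ord (w e); have wfn := ltn_ord (w f);
  rewrite /edge_key /edge_a /edge_b /edge_J ?eK ?fK.
- have [h1 h2 h3 h4] := next_smallerP eK; have [k1 k2 k3 k4] := next_smallerP fK.
  rewrite !inE -!val_eqE /= => ef.
  have := h4 f; have := k4 e; have := k4 (next_smaller e).
  have := @wcong f (next_smaller e); have := @wcong e f; lia.
- have -> : (f <= K0) = false by lia.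
  have [h1 h2 h3 h4] := next_smallerP eK; have [k1 k2 k3 k4] := prev_largerP (ltnW fK).
  rewrite !inE -!val_eqE /= => ef.
  have := k4 K1; case: (ltnP (w K1) (w f)) ef => k5 ef; lia.
- have -> : (e <= K0) = false by lia.
  have [h1 h2 h3 h4] := prev_largerP (ltnW eK); have [k1 k2 k3 k4] := next_smallerP fK.
  rewrite !inE -!val_eqE /= => ef.
  have := @wcong (prev_larger e) K1; have := h4 K1; case: (ltnP (w K1) (w e)) ef => k5 ef; lia.
- have -> : (e <= K0) = false by lia.
  have -> : (f <= K0) = false by lia.
  have [h1 h2 h3 h4] := prev_largerP (ltnW eK); have [k1 k2 k3 k4] := prev_largerP (ltnW fK).
  rewrite !inE -!val_eqE /= => ef.
  have {}ef : w f < w e by move: ef; case_ifs; lia.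
  have := h4 f; have := k4 e; have := k4 (prev_larger e).
  have := @wcong f (prev_larger e); have := @wcong e f; lia.
Qed.

Definition edge_J' e : {set 'I_n} := edge_a e |: (edge_J e :\ edge_b e).

Lemma edge_J'_low e q : e <= K0 -> (q \in edge_J' e) =
  (e <= q) && (if next_smaller e == K1 then q != K1 else q < next_smaller e).
Proof.
move=> eK; have [h1 h2 h3 h4] := next_smallerP eK.
rewrite /edge_J' /edge_a /edge_b /edge_J eK in_setU1 in_setD1 inE -!val_eqE /=.
by case: ifP; lia.
Qed.

Lemma edge_J'_up e q : K1 < e -> (q \in edge_J' e) =
  if prev_larger e == K0 then (e < q) || (q == K0) else (q <= prev_larger e) || (e < q).
Proof.
move=> eK; have [h1 h2 h3 h4] := prev_largerP (ltnW eK).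
rewrite /edge_J' /edge_a /edge_b /edge_J (_ : (e <= K0) = false); last by lia.
rewrite in_setU1 in_setD1 inE -!val_eqE /=.
by case: ifP; lia.
Qed.

Lemma edge_J_earlier e f : e != K1 -> f != K1 -> edge_key f < edge_key e ->
  (edge_a f \in edge_J' e) = (edge_b f \in edge_J' e).
Proof.
have wKn := ltn_ord (w K1).
elim/edge_cases: e / => e eK; elim/edge_cases: f / => f fK;
  have wen := ltn_ord (w e); have wfn := ltn_ord (w f);
  rewrite /edge_key /edge_a /edge_b ?eK ?fK.
- have [h1 h2 h3 h4] := next_smallerP eK; have [k1 k2 k3 k4] := next_smallerP fK.
  rewrite !edge_J'_low // -!val_eqE /= => ef.
  have := h4 f; have := h4 (next_smaller f); have := k4 e.
  have := @wcong e (next_smaller f); have := @wcong f (next_smaller e); have := @wcong e f.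
  by case: ifP; lia.
- have -> : (f <= K0) = false by lia.
  have [h1 h2 h3 h4] := next_smallerP eK; have [k1 k2 k3 k4] := prev_largerP (ltnW fK).
  rewrite !edge_J'_low // -!val_eqE /= => ef.
  have := k4 K1; have := @wcong (prev_larger f) K1.
  by case: ifP; case: (ltnP (w K1) (w f)) ef => k5 ef; lia.
- have -> : (e <= K0) = false by lia.
  have [h1 h2 h3 h4] := prev_largerP (ltnW eK); have [k1 k2 k3 k4] := next_smallerP fK.
  rewrite !edge_J'_up // -!val_eqE /= => ef.
  have := h4 K1; case: ifP; case: (ltnP (w K1) (w e)) ef => k5 ef; lia.
- have -> : (e <= K0) = false by lia.
  have -> : (f <= K0) = false by lia.
  have [h1 h2 h3 h4] := prev_largerP (ltnW eK); have [k1 k2 k3 k4] := prev_largerP (ltnW fK).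
  rewrite !edge_J'_up // -!val_eqE /= => ef.
  have {}ef : w e < w f by move: ef; case_ifs; lia.
  have := h4 f; have := h4 (prev_larger f); have := k4 e.
  have := @wcong e (prev_larger f); have := @wcong f (prev_larger e); have := @wcong e f.
  by case: ifP; lia.
Qed.

Let content_complE G y : content (~: G) y = \sum_(i < n) i - content G y.
Proof. by have := content_compl G y; lia. Qed.

Lemma content_edge_I_mid y (t : nat) : K1 <= t ->
  (forall q, (q \in up_block w K1) = (K1 <= q < t.+1)) ->
  content (edge_I K0) y = content (low_block w K0) y + \sum_(p < n | t < p) y p.
Proof.
move=> tK tE; pose G := [set q : 'I_n | t < q].
have -> : edge_I K0 = low_block w K0 :|: G.
  apply/finset.setP => q; rewrite edge_I_mid finset.in_setU tE [q \in G]inE.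
  by congr (_ || _); lia.
rewrite content_U; first by congr (_ + _); apply: eq_bigl => q; rewrite inE.
rewrite -finset.setI_eq0; apply/eqP/finset.setP => q.
rewrite finset.in_setI [q \in G]inE finset.in_set0; apply/negP => /andP[/low_le].
by lia.
Qed.

(** When the parent lies across the middle, the set is the complement of a prefix up to one place;
    otherwise it is an interval or the complement of one. *)
Lemma content_J'_low e y : e <= K0 -> content (edge_J' e) y =
  if next_smaller e == K1 then \sum_(i < n) i - (pre id y e + y K1)
  else \sum_(p < n | e <= p < next_smaller e) y p.
Proof.
move=> eK; have [h1 h2 h3 h4] := next_smallerP eK; case: ifP => nK; last first.
  by apply: eq_bigl => q; rewrite edge_J'_low // nK.
have -> : edge_J' e = ~: (K1 |: [set q : 'I_n | q < e]).
  apply/finset.setP => q; rewrite edge_J'_low // nK finset.in_setC in_setU1 inE.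
  by rewrite negb_or -leqNgt andbC.
rewrite content_complE content_U1 ?inE 1?addnC; last by lia.
by congr (_ - (_ + _)); apply: eq_bigl => q; rewrite inE.
Qed.

Lemma content_J_low e y : e <= K0 -> content (edge_J e) y =
  if next_smaller e == K1 then \sum_(i < n) i - pre id y e.+1
  else \sum_(p < n | e < p < (next_smaller e).+1) y p.
Proof.
move=> eK; rewrite /edge_J eK; case: ifP => nK; last by apply: eq_bigl => q; rewrite inE.
rewrite (_ : [set q : 'I_n | _] = ~: [set q : 'I_n | q < e.+1]).
  by rewrite content_complE; congr (_ - _); apply: eq_bigl => q; rewrite inE.
by apply/finset.setP => q; rewrite finset.in_setC !inE /=; lia.
Qed.

Lemma content_J'_up e y : K1 < e -> content (edge_J' e) y =
  if prev_larger e == K0 then \sum_(i < n) i - pre id y e.+1 + y K0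
  else \sum_(i < n) i - \sum_(p < n | prev_larger e < p < e.+1) y p.
Proof.
move=> eK; have [h1 h2 h3 h4] := prev_largerP (ltnW eK); case: ifP => nK.
  have -> : edge_J' e = K0 |: ~: [set q : 'I_n | q < e.+1].
    apply/finset.setP => q; rewrite edge_J'_up // nK in_setU1 finset.in_setC inE.
    by rewrite orbC; congr (_ || _); lia.
  rewrite content_U1 ?finset.in_setC ?inE; last by lia.
  by rewrite addnC content_complE; congr (_ - _ + _); apply: eq_bigl => q; rewrite inE.
have -> : edge_J' e = ~: [set q : 'I_n | prev_larger e < q < e.+1].
  by apply/finset.setP => q; rewrite edge_J'_up // nK finset.in_setC inE; lia.
by rewrite content_complE; congr (_ - _); apply: eq_bigl => q; rewrite inE.
Qed.

Lemma content_J_up e y : K1 < e -> content (edge_J e) y =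
  if prev_larger e == K0 then \sum_(i < n) i - pre id y e
  else \sum_(i < n) i - \sum_(p < n | prev_larger e <= p < e) y p.
Proof.
move=> eK; rewrite /edge_J (_ : (e <= K0) = false); last by lia.
case: ifP => nK.
  rewrite (_ : [set q : 'I_n | _] = ~: [set q : 'I_n | q < e]).
    by rewrite content_complE; congr (_ - _); apply: eq_bigl => q; rewrite inE.
  by apply/finset.setP => q; rewrite finset.in_setC !inE /=; lia.
rewrite (_ : [set q : 'I_n | _] = ~: [set q : 'I_n | prev_larger e <= q < e]).
  by rewrite content_complE; congr (_ - _); apply: eq_bigl => q; rewrite inE.
by apply/finset.setP => q; rewrite finset.in_setC !inE /=; lia.
Qed.

Let preL : forall F i, i <= K0 -> pre F v i.+1 + F (w i) = pre F w i.+1 + F (w K1).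
Proof. by case: vw. Qed.
Let preR : forall F i, K1 <= i -> pre F v i + F (w K0) = pre F w i + F (w i).
Proof. by case: vw. Qed.

Section Bounds.

Variable z : 'S_n.
Hypothesis vz : bruhat_le v z.
Hypothesis zw : bruhat_le z w.

(** For a parent across the middle this is a prefix comparison with [v], whose prefix is that of [w]
    with one entry exchanged; otherwise it is the interval bound obtained by truncation. *)
Lemma edge_J_le e : e != K1 -> content (edge_J e) z <= content (edge_J' e) w.
Proof.
elim/edge_cases: e / => e eK.
  have [h1 h2 h3 h4] := next_smallerP eK; rewrite content_J_low // content_J'_low //.
  case: ifP => nK.
    have := preL id eK; have := pre_id_ge vz e.+1; rewrite (preS _ w) /=; lia.
  apply: (low_edge_le vw vz zw) => //; move: nK; rewrite -val_eqE /=; lia.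
have [h1 h2 h3 h4] := prev_largerP (ltnW eK); rewrite content_J_up // content_J'_up //.
case: ifP => nK.
  have := preR id (ltnW eK); have := pre_id_ge vz e; rewrite (preS _ w) /=.
  have : pre id w e.+1 <= \sum_(i < n) i.
    by rewrite -(pre_total w) -(preD id w (ltn_ord e)) leq_addr.
  by rewrite preS /=; lia.
apply: leq_sub2l; apply: (up_edge_ge vw vz zw) => //.
by move: nK; rewrite -val_eqE /=; lia.
Qed.

(** Absence of type (3): under these side conditions a descent [w j < w i] would be a cover. *)
Hypothesis gap : forall i j, i < K0 -> K1 < j ->
  (forall p, i < p <= K0 -> w i < w p) -> (forall p, K1 <= p < j -> w p < w j) ->
  w i < w j.

(** At the common edge, [gap] orders the two entries adjacent to the blocks, as the choice of a
    threshold there requires. *)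
Lemma edge_I_le e : e != K1 -> content (edge_I e) z <= content (edge_I e) w.
Proof.
elim/edge_cases: e / => e eK.
  have [eK0|/negP eK0] := boolP (e < K0).
    by rewrite /edge_I eK0; apply: (low_block_le vw).
  rewrite (edge_K0P eK0 eK).
  have [s [sK sE sr s1]] := low_block_interval w K0.
  have [t [tK tE tr t1]] := up_block_interval w K1.
  rewrite !(content_edge_I_mid _ tK tE); apply: (mid_block_le vw vz zw sE) => // p q ps qt.
  apply: gap.
  - by lia.
  - by lia.
  - move=> r pr; have := sr r; have [->|] := eqVneq r K0; first by have := s1 p ps; lia.
    by rewrite -val_eqE /= => rK h; apply: leq_trans (h _); [have := s1 p ps; lia|lia].
  - move=> r rq; have := tr r; have [->|] := eqVneq r K1; first by have := t1 q qt; lia.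
    by rewrite -val_eqE /= => rK h; have := t1 q qt; have := h ltac:(lia); lia.
have -> : edge_I e = ~: up_block w e.
  by apply/finset.setP => q; rewrite edge_I_up // finset.in_setC.
have := up_block_ge vw vz zw (ltnW eK).
by rewrite !content_complE; lia.
Qed.

End Bounds.

End Tree.

(** * Exchanges along the tree are descents *)

Section Process.

Variables (n : nat) (v w : 'S_n) (K0 K1 : 'I_n).
Implicit Types (u x y z : 'S_n) (i j p q e f r : 'I_n) (t : nat).
Hypothesis vw : coxeter_pair v w K0 K1.
Hypothesis gap : forall i j, i < K0 -> K1 < j ->
  (forall p, i < p <= K0 -> w i < w p) -> (forall p, K1 <= p < j -> w p < w j) ->
  w i < w j.

Let K10 : K1 = K0.+1 :> nat. Proof. by case: vw. Qed.
Let wK1 : forall i, i <= K0 -> w K1 < w i. Proof. by case: vw. Qed.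

Local Notation nxt := (next_smaller w K1).
Local Notation prv := (prev_larger w K0).
Local Notation ea := (edge_a w K0).
Local Notation eb := (edge_b w K0 K1).
Local Notation ekey := (edge_key w K0 K1).

(* What the edges of key at least t find in y when they come to be exchanged. *)
Definition pending t y : Prop :=
  [/\ forall e, e != K0 -> e != K1 -> t <= ekey e -> y e = w e,
      forall e, e < K0 -> t <= ekey e -> y (nxt e) < w e,
      forall e, K1 < e -> t <= ekey e -> w e < y (prv e) &
      t <= ekey K0 ->
        (y K1 = w K1 \/ exists e, [/\ e < K0, nxt e = K1 & y K1 = w e]) /\
        (y K0 = w K0 \/ exists f, [/\ K1 < f, prv f = K0 & y K0 = w f])].

Lemma pending_mono t y : pending t y -> pending t.+1 y.
Proof.
case=> h1 h2 h3 h4; split=> *; [exact/h1/ltnW|exact/h2/ltnW|exact/h3/ltnW|].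
exact/h4/ltnW.
Qed.

Lemma pending0 : pending 0 w.
Proof.
split=> // [e eK _|e eK _|_]; last by split; left.
- by have [] := next_smallerP vw (ltnW eK).
- by have [] := prev_largerP vw (ltnW eK).
Qed.

(** In the extreme case [K1] holds the entry of a left child [e] and [K0] that of a right child [f];
    these satisfy the side conditions of (3), so [gap] orders them. *)
Lemma pending_mid t y : t <= ekey K0 -> pending t y ->
  [/\ y K1 < y K0, y K1 < w K0 & w K1 < y K0].
Proof.
move=> tK [_ _ _ /(_ tK)[hy1 hy0]].
have nK e : e < K0 -> nxt e = K1 -> forall p, e < p <= K0 -> w e < w p.
  move=> eK E p pe; have [_ _ _] := next_smallerP vw (ltnW eK); rewrite E; apply; lia.
have pK f : K1 < f -> prv f = K0 -> forall p, K1 <= p < f -> w p < w f.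
  move=> fK E p pf; have [_ _ _] := prev_largerP vw (ltnW fK); rewrite E; apply; lia.
have h10 := wK1 (leqnn K0).
case: hy1 => [->|[e [eK eE ->]]]; case: hy0 => [->|[f [fK fE ->]]].
- by [].
- by have h := pK _ fK fE K1; split=> //; apply: h; lia.
- by have h := nK _ eK eE K0; split=> //; apply: h; lia.
- have h1 := nK _ eK eE; have h2 := pK _ fK fE.
  by split; [apply: gap|apply: h1; lia|apply: h2; lia].
Qed.

Lemma edge_descent e y : e != K1 -> pending (ekey e) y -> y (eb e) < y (ea e).
Proof.
move: e; apply: (edge_cases vw) => e eK h; have [h1 h2 h3 h4] := h.
- rewrite edge_aL ?edge_bL //; have [eK0|/negP eK0] := boolP (e < K0).
    by rewrite (h1 e) ?h2 // -val_eqE /=; lia.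
  rewrite (edge_K0P vw eK0 eK) in h *.
  have [k1 k2 k3 k4] := next_smallerP vw (leqnn K0).
  have -> : nxt K0 = K1 by apply: val_inj => /=; lia.
  by have [] := pending_mid (leqnn _) h.
- by rewrite (edge_aR vw) ?(edge_bR vw) // (h1 e) ?h3 // -val_eqE /=; lia.
Qed.

Lemma edge_keyL e : e <= K0 -> ekey e = n + w e.
Proof. by rewrite /edge_key => ->. Qed.

Lemma edge_keyR e : K1 < e -> ekey e = if w K1 < w e then n - w e else 3 * n - w e.
Proof. by rewrite /edge_key => /(leK0F vw)->. Qed.

Lemma swapE y p q r : (y \ou tperm p q) r =
  if r == p then y q else if r == q then y p else y r.
Proof.
rewrite pmulE; case: tpermP => [->|->|/eqP/negPf-> /eqP/negPf-> //]; rewrite eqxx //.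
by case: eqP => // ->.
Qed.

(** Away from the common edge, the parent end receives [w e0], which later siblings exceed on the
    left and stay below on the right; the other end moves further away from the entries of its own
    children. *)
Lemma pending_swap e0 y : e0 != K1 -> pending (ekey e0) y ->
  pending (ekey e0).+1 (y \ou tperm (ea e0) (eb e0)).
Proof.
have wne e : w e < n by exact: ltn_ord.
have wKn := wne K1.
move: e0; apply: (edge_cases vw) => e0 eK h; have [h1 h2 h3 h4] := h.
  have [k1 k2 k3 k4] := next_smallerP vw eK; rewrite edge_aL ?edge_bL // (edge_keyL eK).
  have [eK0|/negP eK0] := boolP (e0 < K0).
    have ye0 : y e0 = w e0 by apply: h1 => //; rewrite -val_eqE /=; lia.
    have yb0 := h2 _ eK0 (leqnn _).
    split=> [e eK0' eK1 te|e eL te|e eR te|te].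
    - move: e eK1 eK0' te; apply: (edge_cases vw) => e eL eK0' te; rewrite swapE.
        rewrite edge_keyL // in te.
        have ee0 : e == e0 = false by apply/eqP => E; rewrite E in te; lia.
        have en0 : e == nxt e0 = false by apply/eqP => E; rewrite E in te; lia.
        rewrite ee0 en0; apply: h1 => //; first by rewrite -val_eqE /=; lia.
        by rewrite !edge_keyL //; lia.
      have ee0 : e == e0 = false by apply/eqP => E; move: eL; rewrite E; lia.
      have en0 : e == nxt e0 = false by apply/eqP => E; move: eL; rewrite E; lia.
      rewrite ee0 en0; apply: h1 => //; first by rewrite -val_eqE /=; lia.
      by rewrite (edge_keyL eK) ltnW.
    - have eL' := ltnW eL; rewrite edge_keyL // in te.
      have [l1 l2 l3 l4] := next_smallerP vw eL'; rewrite swapE.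
      case: eqP => [E|_]; first by rewrite E in l3; exact: ltn_trans yb0 l3.
      case: eqP => [_|_]; first by rewrite ye0; lia.
      by apply: h2 => //; rewrite !edge_keyL //; lia.
    - have [l1 l2 l3 l4] := prev_largerP vw (ltnW eR); rewrite swapE.
      case: eqP => [E|_]; first by move: l2; rewrite E; lia.
      case: eqP => [E|_]; first by rewrite ye0; rewrite E in l3; lia.
      by apply: h3 => //; rewrite (edge_keyL eK) ltnW.
    - rewrite edge_keyL // in te; have [|hy1 hy0] := h4; first by rewrite !edge_keyL //; lia.
      have K0e : K0 == e0 = false by rewrite -val_eqE /=; lia.
      have K0b : K0 == nxt e0 = false by apply/eqP => E; rewrite E in te; lia.
      have K1e : K1 == e0 = false by rewrite -val_eqE /=; lia.
      rewrite !swapE K0e K0b K1e; split=> //; case: eqP => [E|_] //.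
      by right; exists e0; rewrite ye0 -E.
  have e0E := edge_K0P vw eK0 eK; rewrite e0E in h *.
  have [m1 m2 m3] := pending_mid (leqnn _) h.
  have nK : nxt K0 = K1 by rewrite e0E in k1 k2; apply: val_inj => /=; lia.
  have keyK : ekey K0 = n + w K0 by rewrite edge_keyL.
  have K10F : K1 == K0 = false by rewrite -val_eqE /=; lia.
  (* After the common edge, [K0] has only left children pending and [K1] only right ones. *)
  rewrite nK; split=> [e eK0' eK1 te|e eL te|e eR te|te]; last by lia.
  - rewrite swapE (negPf eK0') (negPf eK1); apply: h1 => //.
    by rewrite e0E keyK ltnW.
  - have eL' := ltnW eL; have te' := te; rewrite edge_keyL // in te'.
    have [l1 l2 l3 l4] := next_smallerP vw eL'; rewrite swapE.
    case: eqP => [_|_]; first by lia.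
    case: eqP => [E|_]; first by have := l4 K0; rewrite E; lia.
    by apply: h2 => //; rewrite e0E keyK ltnW.
  - have te' := te; rewrite (edge_keyR eR) in te'.
    have [l1 l2 l3 l4] := prev_largerP vw (ltnW eR); rewrite swapE.
    case: eqP => [E|_].
      by have := l4 K1; rewrite E; move: te'; case: ifP => k; have := wne e; lia.
    case: eqP => [E|_]; first by move: te'; case: ifP => k; have := wne e; lia.
    by apply: h3 => //; rewrite e0E keyK ltnW.
have [k1 k2 k3 k4] := prev_largerP vw (ltnW eK); rewrite (edge_aR vw) ?(edge_bR vw) //.
have ye0 : y e0 = w e0 by apply: h1 => //; rewrite -val_eqE /=; lia.
have yb0 := h3 _ eK (leqnn _).
have we0 := wne e0.
split=> [e eK0' eK1 te|e eL te|e eR te|te].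
- move: e eK1 eK0' te; apply: (edge_cases vw) => e eL eK0' te; rewrite swapE.
    have ee0 : e == e0 = false by apply/eqP => E; move: eL; rewrite E; lia.
    have en0 : e == prv e0 = false.
      by apply/eqP => E; move: eL eK0'; rewrite E -val_eqE /=; lia.
    rewrite ee0 en0; apply: h1 => //; first by rewrite -val_eqE /=; lia.
    exact: ltnW.
  have te' := te; rewrite !edge_keyR // in te'.
  have ee0 : e == e0 = false by apply/eqP => E; move: te'; rewrite E ltnn.
  have en0 : e == prv e0 = false.
    by apply/eqP => E; move: te'; rewrite E; case_ifs; have := wne (prv e0); lia.
  rewrite ee0 en0; apply: h1 => //; first by rewrite -val_eqE /=; lia.
  exact: ltnW.
- have [l1 l2 l3 l4] := next_smallerP vw (ltnW eL); rewrite swapE.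
  case: eqP => [E|_]; first by rewrite ye0; rewrite E in l3; lia.
  case: eqP => [E|_]; first by move: l2; rewrite E; lia.
  by apply: h2 => //; exact: ltnW.
- have te' := te; rewrite !edge_keyR // in te'.
  have we := wne e.
  have {}te' : w e < w e0 by move: te'; case_ifs; lia.
  have [l1 l2 l3 l4] := prev_largerP vw (ltnW eR); rewrite swapE.
  case: eqP => [_|_]; first by rewrite ye0.
  case: eqP => [E|_]; first by apply: ltn_trans l3 _; rewrite E.
  by apply: h3 => //; exact: ltnW.
- have [|hy1 hy0] := h4; first exact: ltnW.
  have te' := te; rewrite (edge_keyR eK) edge_keyL // in te'.
  have K1a : K1 == prv e0 = false.
    by apply/eqP => E; rewrite -E in k3; move: te'; have := wne K0; case: ifP; lia.
  have K1e : K1 == e0 = false by rewrite -val_eqE /=; lia.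
  have K0e : K0 == e0 = false by rewrite -val_eqE /=; lia.
  rewrite !swapE K1a K1e K0e; split=> //; case: eqP => [E|_] //.
  by right; exists e0; rewrite ye0 -E.
Qed.

End Process.

Import Order.TTheory GRing.Theory Num.Theory.

(** * Cubical point sets *)

Section Dot.

Local Open Scope ring_scope.
Local Open Scope classical_set_scope.

Variables (R : realType) (d : nat).
Implicit Types (c x y : 'rV[R]_d).

Lemma dotE c x : dot c x = (x *m c^T) 0 0.
Proof. by rewrite mxE; apply: eq_bigr => i _; rewrite mxE mulrC. Qed.

Lemma dotDr c x y : dot c (x + y) = dot c x + dot c y.
Proof. by rewrite !dotE mulmxDl mxE. Qed.

Lemma dotNr c x : dot c (- x) = - dot c x.
Proof. by rewrite !dotE mulNmx mxE. Qed.

Lemma dotBr c x y : dot c (x - y) = dot c x - dot c y.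
Proof. by rewrite dotDr dotNr. Qed.

Lemma dotZr c a x : dot c (a *: x) = a * dot c x.
Proof. by rewrite !dotE -scalemxAl mxE. Qed.

Lemma dot_sumr (I : Type) (r : seq I) (P : pred I) c (F : I -> 'rV[R]_d) :
  dot c (\sum_(i <- r | P i) F i) = \sum_(i <- r | P i) dot c (F i).
Proof.
elim/big_rec2: _ => [|i y x _ <-]; last by rewrite dotDr.
by rewrite dotE mul0mx mxE.
Qed.

Lemma dotDl c c' x : dot (c + c') x = dot c x + dot c' x.
Proof. by rewrite !dotE linearD mulmxDr mxE. Qed.

Lemma dot0l x : dot 0 x = 0 :> R.
Proof. by rewrite dotE linear0 mulmx0 mxE. Qed.

Lemma dot_suml (I : Type) (r : seq I) (P : pred I) (F : I -> 'rV[R]_d) x :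
  dot (\sum_(i <- r | P i) F i) x = \sum_(i <- r | P i) dot (F i) x.
Proof.
elim/big_rec2: _ => [|i y c _ <-]; last by rewrite dotDl.
exact: dot0l.
Qed.

End Dot.

Section Cubical.

Local Open Scope ring_scope.
Local Open Scope classical_set_scope.

Variables (R : realType).

(* Q has a vertex p S for each set S of coordinates and two opposite facets
   for each coordinate e: facet (e, s) contains p S iff (e \in S) = s. *)
Record cubical d N (Q : set 'rV[R]_N) := Cubical {
  cvertex : {set 'I_d} -> 'rV[R]_N;
  cnormal : 'I_d * bool -> 'rV[R]_N;
  cbound : 'I_d * bool -> R;
  cvertexP : forall S, Q (cvertex S);
  cboundP : forall k x, Q x -> dot (cnormal k) x <= cbound k;
  ctightP : forall k S,
    (dot (cnormal k) (cvertex S) == cbound k) = ((k.1 \in S) == k.2);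
  cdimP : exists2 U : 'M[R]_N, (\rank U <= d)%N &
    forall x y, Q x -> Q y -> (x - y <= U)%MS }.

Section Theory.

Variables (d N : nat) (Q : set 'rV[R]_N) (cQ : cubical d Q).
Implicit Types (S : {set 'I_d}) (e : 'I_d) (k : 'I_d * bool) (K : {set 'I_d * bool}).
Let p := cvertex cQ.

Definition slack k x : R := cbound cQ k - dot (cnormal cQ k) x.

Lemma slack_ge0 k x : Q x -> 0 <= slack k x.
Proof. by move=> Qx; rewrite subr_ge0; apply: cboundP. Qed.

Lemma slack_eq0 k S : (slack k (p S) == 0) = ((k.1 \in S) == k.2).
Proof. by rewrite subr_eq0 eq_sym ctightP. Qed.

Definition flip S e : {set 'I_d} := [set x | (x \in S) (+) (x == e)].

Lemma in_flip S e x : (x \in flip S e) = (x \in S) (+) (x == e).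
Proof. by rewrite inE. Qed.

(* The d edges at p S are linearly independent, by pairing them with the
   facets through p S; so they span the direction of Q, and the coordinates
   in this basis are read off from the slacks. *)
Lemma local_cone S x : Q x -> exists a : 'I_d -> R,
  [/\ forall e, 0 <= a e, forall e, (a e == 0) = (slack (e, e \in S) x == 0) &
      forall h, dot h x - dot h (p S) = \sum_e a e * (dot h (p (flip S e)) - dot h (p S))].
Proof.
move=> Qx; pose r e := p (flip S e) - p S.
pose sl e y := slack (e, e \in S) y.
have sl0 e : sl e (p S) = 0 by apply/eqP; rewrite slack_eq0.
have slflip e e' : (sl e (p (flip S e')) == 0) = (e != e').
  by rewrite slack_eq0 in_flip /=; case: (e \in S); case: (e == e').
have slB e y y' : dot (cnormal cQ (e, e \in S)) (y - y') = sl e y' - sl e y.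
  by rewrite dotBr /sl /slack; ring.
pose M := \matrix_(e < d) r e.
pose C := \matrix_(i < N, e < d) cnormal cQ (e, e \in S) 0 i.
have MC e e' : (M *m C) e e' = - sl e' (p (flip S e)).
  rewrite -[RHS]addr0 -(sl0 e') addrC -slB /dot mxE.
  by apply: eq_bigr => i _; rewrite !mxE mulrC.
have free : row_free M.
  apply/row_freeP; exists (C *m diag_mx (\row_e - (sl e (p (flip S e)))^-1)).
  apply/matrixP => e e'; rewrite mulmxA mul_mx_diag mxE MC !mxE.
  have [->|ne] := eqVneq e e'.
    by rewrite mulrNN divff // slflip eqxx.
  by rewrite (eqP (_ : sl e' (p (flip S e)) == 0)) ?oppr0 ?mul0r // slflip eq_sym.
have [U rU sU] := cdimP cQ.
have MU : (M <= U)%MS.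
  by apply/row_subP => e; rewrite rowK; apply: sU; apply: cvertexP.
have UM : (U <= M)%MS.
  rewrite -(geq_leqif (mxrank_leqif_sup MU)).
  by move: free; rewrite /row_free => /eqP->.
have /submxP[a xa] : (x - p S <= M)%MS.
  by apply: submx_trans UM; apply: sU => //; apply: cvertexP.
have hx h : dot h x - dot h (p S) =
    \sum_e a 0 e * (dot h (p (flip S e)) - dot h (p S)).
  rewrite -dotBr xa mulmx_sum_row dot_sumr; apply: eq_bigr => e _.
  by rewrite dotZr rowK dotBr.
have slx e : sl e x = a 0 e * sl e (p (flip S e)).
  have := hx (cnormal cQ (e, e \in S)).
  rewrite -dotBr slB sl0 sub0r (bigD1 e) //= big1 => [|e' ne].
    by rewrite addr0 -dotBr slB sl0 sub0r mulrN => /oppr_inj.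
  rewrite -dotBr slB sl0 sub0r.
  by rewrite (eqP (_ : sl e (p (flip S e')) == 0)) ?oppr0 ?mulr0 // slflip eq_sym.
have slpos e : 0 < sl e (p (flip S e)).
  by rewrite lt_def slflip eqxx /=; apply: slack_ge0; apply: cvertexP.
exists (a 0); split=> // e.
  by rewrite -(pmulr_lge0 _ (slpos e)) -slx; apply: slack_ge0.
by rewrite -/(sl e x) slx mulf_eq0 (gt_eqF (slpos e)) orbF.
Qed.

(** A vertex best among all vertices is no worse than its neighbours, and [Q] lies in the cone
    spanned by the edges there. Equality holds where the coordinates along strictly decreasing edges
    vanish. *)
Lemma max_vertex h : exists S,
  [/\ forall x, Q x -> dot h x <= dot h (p S) &
      forall x, Q x -> (dot h x == dot h (p S)) =
        [forall e, (dot h (p (flip S e)) < dot h (p S)) ==>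
                   (slack (e, e \in S) x == 0)]].
Proof.
have [S _ Smax] := @arg_maxP _ _ _ [set: 'I_d]%SET predT (fun S => dot h (p S)) isT.
have hle e : dot h (p (flip S e)) - dot h (p S) <= 0 by rewrite subr_le0; apply: Smax.
exists S; split=> x Qx; have [a [a0 az ha]] := local_cone S Qx.
  by rewrite -subr_le0 ha sumr_le0 // => e _; apply: mulr_ge0_le0.
rewrite -subr_eq0 ha -oppr_eq0 -sumrN psumr_eq0; last first.
  by move=> e _; rewrite oppr_ge0; apply: mulr_ge0_le0.
apply/allP/forallP => /= H e.
  have := H e (mem_index_enum _); rewrite oppr_eq0 mulf_eq0 az => /orP[->|].
    exact: implybT.
  by rewrite subr_eq0 => /eqP->; rewrite ltxx.
move=> _; have := H e; rewrite -az oppr_eq0 mulf_eq0.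
by case: ltP => [_ /= ->|h' _] //; rewrite [X in _ || X]eq_le hle subr_ge0 h' orbT.
Qed.

(** [box] and [cl] form a Galois connection between sets of facets and subsets of [Q]; sets without
    opposite facets turn out to be closed. *)
Definition box K : set 'rV[R]_N := [set x | Q x /\ forall k, k \in K -> slack k x = 0].

Definition cl (F : set 'rV[R]_N) : {set 'I_d * bool} :=
  [set k | `[< forall x, F x -> slack k x = 0 >]].

Definition consistent K := [forall e, ((e, true) \notin K) || ((e, false) \notin K)].

Lemma clP F k : reflect (forall x, F x -> slack k x = 0) (k \in cl F).
Proof. by rewrite inE; apply: asboolP. Qed.

Lemma cl_anti F F' : F `<=` F' -> cl F' \subset cl F.
Proof. by move=> FF'; apply/fintype.subsetP => k /clP h; apply/clP => x /FF' /h. Qed.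

Lemma box_anti K K' : K \subset K' -> box K' `<=` box K.
Proof. by move=> /fintype.subsetP KK' x [Qx h]; split=> // k /KK' /h. Qed.

Lemma sub_cl_box K : K \subset cl (box K).
Proof. by apply/fintype.subsetP => k kK; apply/clP => x [_ /(_ _ kK)]. Qed.

Lemma sub_box_cl F : F `<=` Q -> F `<=` box (cl F).
Proof. by move=> FQ x Fx; split; [exact: FQ|move=> k /clP; apply]. Qed.

Lemma box_face K : face Q (box K).
Proof.
exists (\sum_(k in K) cnormal cQ k), (\sum_(k in K) cbound cQ k).
split=> [x Qx|].
  by rewrite dot_suml; apply: ler_sum => k _; apply: cboundP.
apply/seteqP; split=> x [Qx h]; split=> //=.
  by rewrite dot_suml; apply: eq_bigr => k /h /eqP; rewrite subr_eq0 => /eqP.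
move=> k kK; move/eqP: h; rewrite eq_sym -subr_eq0 dot_suml -sumrB.
rewrite psumr_eq0 => [/allP/(_ k (mem_index_enum _))|i _]; last exact: slack_ge0.
by rewrite kK => /eqP.
Qed.

(** At a common point of two opposite facets the sum of their functionals would reach the sum of the
    bounds; some vertex would reach it too, but a vertex lies on only one of the two. *)
Lemma box_inconsistent K : ~~ consistent K -> box K = set0.
Proof.
rewrite negb_forall => /existsP[e]; rewrite negb_or !negbK => /andP[kt kf].
apply/seteqP; split=> // x [Qx h].
have [S [Smax _]] := max_vertex (cnormal cQ (e, true) + cnormal cQ (e, false)).
have hx := Smax _ Qx; rewrite !dotDl in hx.
have ht := slack_ge0 (e, true) (cvertexP cQ S).
have hf := slack_ge0 (e, false) (cvertexP cQ S).
have xt := h _ kt; have xf := h _ kf.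
have st : slack (e, true) (p S) = 0 by move: ht hf hx xt xf; rewrite /slack /p; lra.
have sf : slack (e, false) (p S) = 0 by move: ht hf hx xt xf; rewrite /slack /p; lra.
have := slack_eq0 (e, true) S; have := slack_eq0 (e, false) S.
by rewrite st sf eqxx; case: (e \in S).
Qed.

Lemma cl_box K : consistent K -> cl (box K) = K.
Proof.
move=> /forallP cK; apply/eqP; rewrite finset.eqEsubset sub_cl_box andbT.
apply/fintype.subsetP => -[e s] /clP; apply: contraPT => esK.
(* [p S] lies on every facet of [K] and on the facet opposite to [(e, s)]. *)
pose S : {set 'I_d} := [set e' | if e' == e then ~~ s else (e', true) \in K]%SET.
move=> h; have : box K (p S); last first.
  by move/h/eqP; rewrite slack_eq0 inE eqxx; case: (s).
split; first exact: cvertexP.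
move=> [e' s'] kK; apply/eqP; rewrite slack_eq0 inE /=.
  case: (e' =P e) kK => [->|_] kK.
    have [ss|/negPf] := eqVneq s s'; first by rewrite ss kK in esK.
    by case: (s); case: (s').
  case: s' kK => kK; first by rewrite kK.
  by have := cK e'; rewrite kK orbF => /negPf->.
Qed.

Lemma face_sub F : face Q F -> F `<=` Q.
Proof. by case=> c [b [_ ->]] x []. Qed.

(** The optimal face of a functional is cut out by facets through an optimal vertex. If the bound is
    not attained the face is empty, and it is a box once there is a pair of opposite facets, whence
    [0 < d]. *)
Lemma face_box F : face Q F -> (0 < d)%N \/ F !=set0 -> F = box (cl F).
Proof.
move=> fF h; apply/seteqP; split; first exact/sub_box_cl/face_sub.
case: fF h => c [b [cb FE]] h x bx.
have [S [Smax Stight]] := max_vertex c.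
have [bS|bS] := eqVneq b (dot c (p S)).
  have Qx : Q x by case: bx.
  rewrite FE; split=> //=; apply/eqP; rewrite bS Stight //.
  apply/forallP => e; apply/implyP => he; apply/eqP.
  case: bx => _; apply; apply/clP => y; rewrite FE => -[Qy /= yb].
  move/eqP: yb; rewrite bS Stight // => /forallP/(_ e).
  by rewrite he => /eqP.
have F0 : F = set0.
  apply/seteqP; split=> // y; rewrite FE => -[Qy /= yb].
  have := cb _ (cvertexP cQ S); have := Smax _ Qy; rewrite yb => h1 h2.
  by move/eqP: bS; apply; apply/eqP; rewrite eq_le h1.
case: h => [d0|[y]]; last by rewrite F0.
suff: box (cl F) = set0 by move=> E; move: bx; rewrite E.
apply: box_inconsistent; rewrite negb_forall; apply/existsP.
by exists (Ordinal d0); rewrite negb_or !negbK; apply/andP; split; apply/clP => z; rewrite F0.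
Qed.

Lemma cl_consistent F : F !=set0 -> F `<=` Q -> consistent (cl F).
Proof.
move=> [x Fx] FQ; apply/negPn/negP => /box_inconsistent E.
by have := sub_box_cl FQ Fx; rewrite E.
Qed.

End Theory.

(** A face is named by the facets containing it; the possible names, the consistent sets and the
    full set, depend on [d] only. *)
Lemma cubical_equiv d N N' (Q : set 'rV[R]_N) (Q' : set 'rV[R]_N') :
  (0 < d)%N -> cubical d Q -> cubical d Q' -> comb_equiv Q Q'.
Proof.
move=> d0 cQ cQ'; exists (fun F => box cQ' (cl cQ F)).
have clos M (P : set 'rV[R]_M) (cP : cubical d P) F : face P F ->
    ~~ consistent (cl cP F) -> cl cP F = [set: 'I_d * bool]%SET.
  move=> fF nc; apply/finset.setP => k; rewrite finset.in_setT; apply/clP => x.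
  by rewrite (face_box cP fF) ?box_inconsistent //; left.
have transfer M M' (P : set 'rV[R]_M) (P' : set 'rV[R]_M') (cP : cubical d P)
    (cP' : cubical d P') F : face P F -> cl cP' (box cP' (cl cP F)) = cl cP F.
  move=> fF; have [cF|ncF] := boolP (consistent (cl cP F)); first exact: cl_box.
  by apply/eqP; rewrite finset.eqEsubset sub_cl_box andbT (clos _ _ cP F) // finset.subsetT.
split=> [F _|G fG|F F' fF fF'].
- exact: box_face.
- exists (box cQ (cl cQ' G)); first exact: box_face.
  by rewrite transfer // -face_box //; left.
- split=> [/(@cl_anti _ _ _ cQ')|FF']; last exact/box_anti/cl_anti.
  rewrite !transfer // => h.
  by rewrite (face_box cQ fF) 1?(face_box cQ fF'); try (by left); apply: box_anti.
Qed.

Lemma cube_cubical d : cubical d (cube R d).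
Proof.
pose p (S : {set 'I_d}) : 'rV[R]_d := \row_e (e \in S)%:R.
(* [(e, true)] is the facet x_e = 1 and [(e, false)] the facet -x_e = 0. *)
pose c (k : 'I_d * bool) : 'rV[R]_d := (-1) ^+ (~~ k.2) *: delta_mx 0 k.1.
have dc k x : dot (c k) x = (-1) ^+ (~~ k.2) * x 0 k.1.
  rewrite /dot (bigD1 k.1) //= big1 => [|i ik]; rewrite !mxE eqxx /=.
    by rewrite eqxx mulr1 addr0.
  by rewrite (negPf ik) mulr0 mul0r.
apply: (@Cubical d d _ p c (fun k => k.2%:R)) => [S i|[e s] x h|[e s] S|].
- by rewrite mxE; case: (_ \in _); rewrite ?lexx ?ler01.
- rewrite dc /=; have /andP[h0 h1] := h e.
  by case: s => /=; rewrite ?expr0 ?expr1 ?mul1r ?mulN1r ?oppr_le0.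
- rewrite dc mxE /=; case: s; case: (e \in S);
  by rewrite ?expr0 ?expr1 ?mul1r ?mulr0 ?mulN1r ?eqxx ?oppr_eq0 ?oner_eq0 // eq_sym oner_eq0.
- by exists 1%:M; [rewrite mxrank1|move=> x y _ _; apply: submx1].
Qed.

End Cubical.

(** * Faces of convex hulls *)

Section ConvexHull.

Local Open Scope ring_scope.
Local Open Scope classical_set_scope.

Variables (R : realType) (I : finType) (N : nat) (A : {set I}) (p : I -> 'rV[R]_N).
Implicit Types (F H : set 'rV[R]_N) (T : {set I}).
Let Q := conv_hull A p.

Lemma conv_vertex z : z \in A -> Q (p z).
Proof.
move=> zA; exists (fun y => (y == z)%:R); split=> [y _||].
- exact: ler0n.
- rewrite (bigD1 z) //= eqxx big1 ?addr0 // => y /andP[_ /negPf->] //.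
- rewrite (bigD1 z) //= eqxx scale1r big1 ?addr0 // => y /andP[_ /negPf->].
  by rewrite scale0r.
Qed.

Lemma conv_sub T T' : T \subset T' -> conv_hull T p `<=` conv_hull T' p.
Proof.
move=> /fintype.subsetP TT' x [a [a0 a1 xE]].
have res (V : nmodType) (F : I -> V) :
    \sum_(z in T') (if z \in T then F z else 0) = \sum_(z in T) F z.
  rewrite -big_mkcondr; apply: eq_bigl => z /=.
  by rewrite andbC; case: (boolP (z \in T)) => //= /TT' ->.
exists (fun z => if z \in T then a z else 0); split.
- by move=> z _; case: ifP => // /a0.
- by rewrite res.
- rewrite xE -res; apply: eq_bigr => z _; case: ifP => _ //.
  by rewrite scale0r.
Qed.

(** The slack of a convex combination is the same combination of nonnegative slacks, so it vanishes
    only if all weights off the tight points do. *)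
Lemma conv_face c b : (forall z, z \in A -> dot c (p z) <= b) ->
  (forall x, Q x -> dot c x <= b) /\
  Q `&` [set x | dot c x = b] =
    conv_hull [set z in A | dot c (p z) == b]%SET p.
Proof.
move=> cb.
have gap a : \sum_(z in A) a z = 1 ->
    b - dot c (\sum_(z in A) a z *: p z) = \sum_(z in A) a z * (b - dot c (p z)).
  move=> a1; rewrite dot_sumr -[b in LHS]mul1r -a1 mulr_suml -sumrB.
  by apply: eq_bigr => z _; rewrite dotZr mulrBr.
split=> [x [a [a0 a1 ->]]|].
  rewrite -subr_ge0 gap //; apply: sumr_ge0 => z zA.
  by rewrite mulr_ge0 ?a0 // subr_ge0 cb.
apply/seteqP; split=> x.
  move=> [[a [a0 a1 ->]] /= /eqP]; rewrite eq_sym -subr_eq0 gap //.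
  rewrite psumr_eq0 => [/allP h|z zA]; last by rewrite mulr_ge0 ?a0 // subr_ge0 cb.
  have az z : z \in A -> dot c (p z) != b -> a z = 0.
    move=> zA; have := h z (mem_index_enum _); rewrite zA mulf_eq0 subr_eq0 /=.
    by rewrite [b == _]eq_sym => /orP[/eqP|->].
  have res (V : nmodType) (F : I -> V) : (forall z, a z = 0 -> F z = 0) ->
      \sum_(z in [set z in A | dot c (p z) == b]%SET) F z = \sum_(z in A) F z.
    move=> F0; rewrite [RHS](bigID (fun z => dot c (p z) == b)) /=.
    rewrite [X in _ = _ + X]big1 ?addr0 => [|z /andP[zA zb]]; last exact/F0/az.
    by apply: eq_bigl => z; rewrite inE.
  exists a; split; rewrite ?res // => z; first by rewrite inE => /andP[/a0].
  by move=> ->; rewrite scale0r.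
move=> xT; have sT : [set z in A | dot c (p z) == b]%SET \subset A.
  by apply/fintype.subsetP => z; rewrite inE => /andP[].
split; first exact: conv_sub sT _ xT.
case: xT => a [_ a1 ->] /=.
rewrite dot_sumr -[RHS]mul1r -a1 mulr_suml; apply: eq_bigr => z.
by rewrite inE dotZr => /andP[_ /eqP->].
Qed.

(** Recovers a face of the hull, so that comparing faces becomes comparing finite sets. *)
Definition vset H : {set I} := [set z in A | `[< H (p z) >]]%SET.

Lemma face_vset H : face Q H -> H = conv_hull (vset H) p.
Proof.
case=> c [b [cb HE]]; rewrite {1}HE.
rewrite (conv_face (fun z zA => cb _ (conv_vertex zA))).2; congr conv_hull.
apply/finset.setP => z; rewrite !inE; case: (boolP (z \in A)) => //= zA.
apply/eqP/asboolP => [h|]; rewrite HE; last by case.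
by split=> //; apply: conv_vertex.
Qed.

Lemma vset_sub H H' : H `<=` H' -> vset H \subset vset H'.
Proof.
move=> HH'; apply/fintype.subsetP => z; rewrite !inE => /andP[-> /asboolP h].
exact/asboolP/HH'.
Qed.

End ConvexHull.

(** * Atoms above a vertex, and an obstruction to being a cube *)

Section NotCube.

Local Open Scope ring_scope.
Local Open Scope classical_set_scope.

Variables (R : realType).

Lemma comb_equiv_inj d e (P : set 'rV[R]_d)
    (f : set 'rV[R]_d -> set 'rV[R]_e) F F' :
  (forall F F', face P F -> face P F' -> (f F `<=` f F' <-> F `<=` F')) ->
  face P F -> face P F' -> f F = f F' -> F = F'.
Proof.
move=> fmono fF fF' E; apply/seteqP; split; apply/fmono => //; rewrite E //.
Qed.

(* The faces above a vertex of a cube form a Boolean lattice, in which an atom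
   below the join of two atoms is one of them. *)
Lemma cubical_atoms d N (Q : set 'rV[R]_N) (cQ : cubical d Q)
    (W B C D : set 'rV[R]_N) :
  let atom X := [/\ face Q X, W `<=` X, X <> W &
    forall H, face Q H -> W `<=` H -> H `<=` X -> H = W \/ H = X] in
  face Q W -> W !=set0 -> atom B -> atom C -> atom D ->
  (forall H, face Q H -> C `<=` H -> D `<=` H -> B `<=` H) ->
  B = C \/ B = D.
Proof.
move=> atom fW W0 [fB WB BW atB] [fC WC _ atC] [fD WD _ atD] join.
have X0 X : W `<=` X -> X !=set0 by case: W0 => x Wx h; exists x; apply: h.
have bX X : face Q X -> W `<=` X -> X = box cQ (cl cQ X).
  by move=> fX /X0 ?; apply: face_box => //; right.
have CDB : cl cQ C :&: cl cQ D \subset cl cQ B.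
  apply: fintype.subset_trans (sub_cl_box cQ _) _; apply: cl_anti.
  apply: join; first exact: box_face.
    by rewrite {1}(bX C) //; apply/box_anti/subsetIl.
  by rewrite {1}(bX D) //; apply/box_anti/subsetIr.
have BWcl : cl cQ B \subset cl cQ W by apply: cl_anti.
have [k kW kB] : exists2 k, k \in cl cQ W & k \notin cl cQ B.
  have [WBs|/subsetPn//] := boolP (cl cQ W \subset cl cQ B).
  case: BW; rewrite (bX B) // (bX W) //.
  by congr box; apply/eqP; rewrite finset.eqEsubset BWcl.
have consW : consistent (cl cQ W) by apply: cl_consistent => //; apply: face_sub fW.
(* Dropping the facet [k] gives a face strictly above [W] that lies in [B] and in whichever of [C],
   [D] is not contained in [k]; it equals both atoms. *)
pose H := box cQ (cl cQ W :\ k).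
have fH : face Q H by apply: box_face.
have WH : W `<=` H by rewrite {1}(bX W) //; apply/box_anti/subsetDl.
have HW : H <> W.
  move=> E; have : cl cQ H = cl cQ W :\ k.
    apply: cl_box; apply/forallP => e; have /forallP/(_ e) := consW.
    by rewrite !in_setD1 !negb_and => /orP[->|->]; rewrite orbT //= orbT.
  by rewrite E => /finset.setP/(_ k); rewrite kW in_setD1 eqxx.
have HX X : face Q X -> W `<=` X -> k \notin cl cQ X -> H `<=` X.
  move=> fX WX kX; rewrite (bX X) //; apply: box_anti.
  apply/fintype.subsetP => k' k'X; rewrite in_setD1.
  have := fintype.subsetP (cl_anti cQ WX) _ k'X => ->; rewrite andbT.
  by apply: contraNneq kX => <-.
have HB : H = B by have [] := atB H fH WH (HX _ fB WB kB).
have : (k \notin cl cQ C) || (k \notin cl cQ D).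
  rewrite -negb_and; apply: contra kB => kCD.
  by apply: (fintype.subsetP CDB); rewrite finset.in_setI.
case/orP=> kX; [left|right]; rewrite -HB.
  by have [] := atC H fH WH (HX _ fC WC kX).
by have [] := atD H fH WH (HX _ fD WD kX).
Qed.

Definition exposed (I : finType) N (A T : {set I}) (p : I -> 'rV[R]_N) : Prop :=
  exists (c : 'rV[R]_N) (b : R), forall z, z \in A ->
    dot c (p z) <= b /\ (dot c (p z) == b) = (z \in T).

(** If a functional is maximal at [w], [z2] and [z3], the relation makes a positive combination of
    its slacks at [z1] and [z4] vanish, so it is maximal at [z1] too. *)
Lemma not_cube (I : finType) N (A : {set I}) (p : I -> 'rV[R]_N)
    (w z1 z2 z3 z4 : I) (a1 a2 a3 a4 : R) :
  [set w; z1; z2; z3; z4]%SET \subset A -> z1 \notin [set w; z2; z3]%SET ->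
  z2 != w -> z3 != w ->
  exposed A [set w]%SET p -> exposed A [set w; z1]%SET p ->
  exposed A [set w; z2]%SET p -> exposed A [set w; z3]%SET p ->
  0 < a1 -> 0 < a4 ->
  a1 *: (p z1 - p w) + a4 *: (p z4 - p w) = a2 *: (p z2 - p w) + a3 *: (p z3 - p w) ->
  ~ exists d, comb_equiv (conv_hull A p) (cube R d).
Proof.
move=> sA z1n z2w z3w exw ex1 ex2 ex3 a10 a40 rel [d [f [fface fsurj fmono]]].
set Q := conv_hull A p in fface fsurj fmono.
have [wA z1A z2A z3A z4A] : [/\ w \in A, z1 \in A, z2 \in A, z3 \in A & z4 \in A].
  by split; apply: (fintype.subsetP sA); rewrite !inE eqxx ?orbT.
pose F (T : {set I}) := conv_hull T p.
have Fface (T : {set I}) : T \subset A -> exposed A T p -> face Q (F T) /\ vset A p (F T) = T.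
  move=> TA [c [b cb]].
  have [h1 h2] := conv_face (fun z zA => (cb z zA).1).
  have E : [set z in A | dot c (p z) == b]%SET = T.
    apply/finset.setP => z; rewrite inE; case: (boolP (z \in A)) => [/cb[]//|zA].
    by apply/esym/negP => /(fintype.subsetP TA); apply/negP.
  rewrite E in h2; split; first by exists c, b.
  apply/finset.setP => z; rewrite -[in RHS]E !inE; case: (boolP (z \in A)) => //= zA.
  apply/asboolP/eqP; rewrite /F -h2; first by case.
  by move=> ?; split=> //; apply: conv_vertex.
have s1 z : z \in A -> [set w; z]%SET \subset A.
  by move=> zA; apply/fintype.subsetP => y; rewrite !inE => /orP[]/eqP->.
have [fW vW] : face Q (F [set w]%SET) /\ vset A p (F [set w]%SET) = [set w]%SET.
  by apply: Fface => //; apply/fintype.subsetP => y; rewrite !inE => /eqP->.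
have vpair z (zA : z \in A) := Fface _ (s1 z zA).
have z1w : z1 != w by apply: contraNneq z1n => ->; rewrite !inE eqxx.
(* An empty image would lie inside the image of the empty face, forcing the vertex itself to be
   empty. *)
have gW0 : f (F [set w]%SET) !=set0.
  apply/set0P; apply/eqP => E.
  have f0 : face Q set0.
    exists 0, 1; split=> [x _|]; first by rewrite dot0l ler01.
    apply/seteqP; split=> // x [_] /=; rewrite dot0l => /eqP.
    by rewrite eq_sym oner_eq0.
  have : F [set w]%SET `<=` set0 by apply/(fmono _ _ fW f0); rewrite E.
  move/(_ (p w)); apply; rewrite /F; have := conv_vertex p (set11 w); exact.
pose atom X := [/\ face (cube R d) X, f (F [set w]%SET) `<=` X, X <> f (F [set w]%SET) &
    forall H, face (cube R d) H -> f (F [set w]%SET) `<=` H -> H `<=` X ->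
      H = f (F [set w]%SET) \/ H = X].
have atomX z : z \in A -> z != w -> exposed A [set w; z]%SET p ->
    atom (f (F [set w; z]%SET)).
  move=> zA zw exz; have [fz vz] := vpair z zA exz.
  have sub : F [set w]%SET `<=` F [set w; z]%SET.
    by apply: conv_sub; apply/fintype.subsetP => y; rewrite !inE => ->.
  split; [exact: fface|exact/fmono| |].
    move/(comb_equiv_inj fmono fz fW)/(congr1 (vset A p)); rewrite vz vW.
    by move/finset.setP/(_ z); rewrite !inE eqxx orbT (negPf zw).
  move=> H fH; have [G fG <-] := fsurj H fH.
  move=> /fmono-/(_ fW fG)/(vset_sub A p) + /fmono-/(_ fG fz)/(vset_sub A p).
  rewrite vW vz => wG Gz.
  have [zG|zG] := boolP (z \in vset A p G); [right|left];
    rewrite {1}(face_vset fG); congr (f (conv_hull _ p)).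
    apply/eqP; rewrite finset.eqEsubset Gz; apply/fintype.subsetP => y.
    rewrite !inE => /orP[]/eqP->; last by move: zG; rewrite inE.
    by have := fintype.subsetP wG w; rewrite !inE eqxx => ->.
  apply/eqP; rewrite finset.eqEsubset wG andbT; apply/fintype.subsetP => y yG.
  have := fintype.subsetP Gz y yG; rewrite !inE => /orP[//|/eqP yz].
  by rewrite -yz yG in zG.
have [f1 v1] := vpair z1 z1A ex1.
have [f2 v2] := vpair z2 z2A ex2.
have [f3 v3] := vpair z3 z3A ex3.
have ne z : face Q (F [set w; z]%SET) -> vset A p (F [set w; z]%SET) = [set w; z]%SET ->
    z1 != z -> f (F [set w; z1]%SET) <> f (F [set w; z]%SET).
  move=> fz vz z1z /(comb_equiv_inj fmono f1 fz)/(congr1 (vset A p)); rewrite v1 vz.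
  by move/finset.setP/(_ z1); rewrite !inE eqxx orbT (negPf z1w) (negPf z1z).
have ne2 : f (F [set w; z1]%SET) <> f (F [set w; z2]%SET).
  by apply: ne => //; apply: contraNneq z1n => ->; rewrite !inE eqxx orbT.
have ne3 : f (F [set w; z1]%SET) <> f (F [set w; z3]%SET).
  by apply: ne => //; apply: contraNneq z1n => ->; rewrite !inE eqxx orbT.
suff join H : face (cube R d) H -> f (F [set w; z2]%SET) `<=` H ->
    f (F [set w; z3]%SET) `<=` H -> f (F [set w; z1]%SET) `<=` H.
  by have [] := cubical_atoms (cube_cubical R d) (fface _ fW) gW0
    (atomX _ z1A z1w ex1) (atomX _ z2A z2w ex2) (atomX _ z3A z3w ex3) join.
move=> fH; have [G fG <-] := fsurj H fH.
move=> /fmono-/(_ f2 fG) G2 /fmono-/(_ f3 fG) G3; apply/fmono => //.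
have pt z y : y \in [set w; z]%SET -> F [set w; z]%SET (p y) by exact: conv_vertex.
have Gw : G (p w) by apply/G2/pt; rewrite !inE eqxx.
have Gz2 : G (p z2) by apply/G2/pt; rewrite !inE eqxx orbT.
have Gz3 : G (p z3) by apply/G3/pt; rewrite !inE eqxx orbT.
have Gz1 : G (p z1).
  case: fG Gw Gz2 Gz3 => c [b [cb ->]] [_ /= hw] [_ /= h2] [_ /= h3].
  split; first exact: conv_vertex.
  have := congr1 (dot c) rel; rewrite !dotDr !dotZr !dotDr !dotNr hw h2 h3 subrr !mulr0 addr0 /=.
  have := cb _ (conv_vertex p z1A); have := cb _ (conv_vertex p z4A).
  move=> h4 h1 E; apply/eqP; rewrite eq_le h1 -subr_ge0 /=.
  have h5 : 0 <= a4 * (b - dot c (p z4)) by rewrite mulr_ge0 ?subr_ge0 // ltW.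
  by rewrite -(pmulr_rge0 _ a10); move: E h5; lra.
rewrite (face_vset fG); apply: conv_sub; apply/fintype.subsetP => y.
by rewrite !inE => /orP[]/eqP->; apply/andP; split=> //; apply/asboolP.
Qed.

End NotCube.

(** * Vertices of the cubical interval *)

Section Vertices.

Variables (n : nat) (v w : 'S_n) (K0 K1 : 'I_n).
Implicit Types (u x y z : 'S_n) (i j p q e f r : 'I_n) (S : {set 'I_n.-1}) (h : 'I_n.-1).
Hypothesis vw : coxeter_pair v w K0 K1.
Hypothesis gap : forall i j, i < K0 -> K1 < j ->
  (forall p, i < p <= K0 -> w i < w p) -> (forall p, K1 <= p < j -> w p < w j) ->
  w i < w j.

Let K10 : K1 = K0.+1 :> nat. Proof. by case: vw. Qed.
Let preL : forall F i, i <= K0 -> pre F v i.+1 + F (w i) = pre F w i.+1 + F (w K1).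
Proof. by case: vw. Qed.
Let preR : forall F i, K1 <= i -> pre F v i + F (w K0) = pre F w i + F (w i).
Proof. by case: vw. Qed.

Local Notation a h := (edge_a w K0 (lift K1 h)).
Local Notation b h := (edge_b w K0 K1 (lift K1 h)).
Local Notation key h := (edge_key w K0 K1 (lift K1 h)).
Local Notation I h := (edge_I w K0 K1 (lift K1 h)).
Local Notation J h := (edge_J w K0 K1 (lift K1 h)).
Local Notation J' h := (edge_J' w K0 K1 (lift K1 h)).

Let liftN h : lift K1 h != K1. Proof. by rewrite eq_sym neq_lift. Qed.

Let key_inj : injective (fun h => key h).
Proof. by move=> h h' /(edge_key_inj vw (liftN h) (liftN h'))/lift_inj. Qed.

(** [lift K1] enumerates the positions other than [K1], matching the coordinates of the cube with
    the edges. *)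
Definition tree_vertex S : 'S_n :=
  final w (fun h => a h) (fun h => b h) (fun h => key h) S.

Lemma run_pending S t :
  pending w K0 K1 t (run w (fun h => a h) (fun h => b h) (fun h => key h) S t).
Proof.
apply: (run_ind key_inj (P := pending w K0 K1)) => [|t' y _|h y _|h y _].
- exact: (pending0 vw).
- exact: pending_mono.
- exact: pending_mono.
- exact: (pending_swap vw gap).
Qed.

Let descent S h : run w (fun h => a h) (fun h => b h) (fun h => key h) S (key h) (b h) <
  run w (fun h => a h) (fun h => b h) (fun h => key h) S (key h) (a h).
Proof. exact: (edge_descent vw gap (liftN h) (run_pending S _)). Qed.

Let I_ends h : a h \in I h /\ b h \notin I h.
Proof. exact: (edge_I_ends vw (liftN h)). Qed.
Let J_ends h : a h \notin J h /\ b h \in J h.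
Proof. exact: (edge_J_ends vw (liftN h)). Qed.
Let I_cross h h' : h' != h -> (a h' \in I h) = (b h' \in I h).
Proof. by move=> hh; apply: (edge_I_cross vw) => //; rewrite (inj_eq lift_inj). Qed.
Let J_later h h' : key h < key h' -> (a h' \in J h) = (b h' \in J h).
Proof. exact: (edge_J_later vw). Qed.
Let J_earlier h h' : key h' < key h -> (a h' \in J' h) = (b h' \in J' h).
Proof. exact: (edge_J_earlier vw). Qed.
Let IJ_lt h i j : i \in I h :\: J h -> j \in J h :\: I h -> i < j.
Proof. exact: (edge_IJ_lt vw). Qed.

Lemma tree_vertex_I S h : content (I h) (tree_vertex S) <= content (I h) w ?= iff (h \notin S).
Proof.
have := final_I key_inj I_ends I_cross descent S h.
rewrite -/(tree_vertex S); move: (fall _ _ _ _ _ _) (fall_gt0 descent S h) => d d0 <-; split; first exact: leq_addr.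
by case: (h \in S) => /=; rewrite ?addn0 ?eqxx //; apply/negbTE/eqP; lia.
Qed.

Lemma tree_vertex_J S h : content (J h) (tree_vertex S) <= content (J' h) w ?= iff (h \in S).
Proof.
have := final_J key_inj J_ends J_later J_earlier descent S h.
rewrite -/(tree_vertex S); move: (fall _ _ _ _ _ _) (fall_gt0 descent S h) => d d0 <-; split; first exact: leq_addr.
by case: (h \in S) => /=; rewrite ?addn0 ?eqxx //; apply/negbTE/eqP; lia.
Qed.

(** All the [J] bounds are equalities here. Read from the common edge outwards, they determine the
    prefix sums one after another, and those of [v] solve the same equations. *)
Lemma tree_vertexT : tree_vertex [set: 'I_n.-1]%SET = v.
Proof.
set z := tree_vertex _.
have tight e : e != K1 -> content (edge_J w K0 K1 e) z = content (edge_J' w K0 K1 e) w.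
  rewrite eq_sym => /unlift_some[h -> _]; apply/eqP.
  by rewrite (tree_vertex_J _ h) finset.in_setT.
have le_total y (p : nat) : pre id y p <= \sum_(i < n) i.
  rewrite /pre -(pre_total y) /pre [leqRHS](bigID (fun i : 'I_n => i < p)) /=.
  apply: leq_trans (leq_addr _ _); apply: eq_leq; apply: eq_bigl => i.
  by rewrite ltn_ord.
have left e : e <= K0 -> pre id z e.+1 = pre id v e.+1.
  have [m] := ubnP (K0 - e); elim: m e => // m IH e em eK.
  have [h1 h2 h3 h4] := next_smallerP vw eK.
  have eK1 : e != K1 by rewrite -val_eqE /=; lia.
  have := tight _ eK1; rewrite (content_J_low vw) // (content_J'_low vw) //.
  have := preL id eK; have := le_total v e.+1; have := le_total z e.+1.
  rewrite (preS _ w) /=; case: ifP => nK; first by lia.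
  have bK : next_smaller w K1 e <= K0 by move: nK; rewrite -val_eqE /=; lia.
  have := IH _ _ bK; have := preL id bK; rewrite (preS _ w) /=.
  have := preD id z (ltnW h1 : e.+1 <= (next_smaller w K1 e).+1).
  have := preD id w (ltnW h1); rewrite /=.
  by move=> e1 e2 e3 /(_ ltac:(lia)) e4 e5 e6 e7 e8; lia.
have right e : K1 <= e -> pre id z e = pre id v e.
  have [m] := ubnP (e : nat); elim: m e => // m IH e em eK.
  have [->|eK1] := eqVneq e K1; first by rewrite K10 left.
  have eK' : K1 < e by move: eK1; rewrite -val_eqE /=; lia.
  have [h1 h2 h3 h4] := prev_largerP vw eK.
  have := tight _ eK1; rewrite (content_J_up vw) // (content_J'_up vw) //.
  have := preR id eK; have := le_total v e; have := le_total z e; have := le_total w e.+1.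
  rewrite (preS _ w) /=; case: ifP => nK; first by lia.
  have aK : K1 <= prev_larger w K0 e by move: nK; rewrite -val_eqE /=; lia.
  have := IH _ _ aK; have := preR id aK; have := preS id w (prev_larger w K0 e).
  have := preD id z (ltnW h1); have := preD id w (ltnW h1 : (prev_larger w K0 e).+1 <= e.+1).
  rewrite !(preS _ w) /=.
  by move=> e1 e2 e3 e4 /(_ ltac:(lia)) e5 e6 e7 e8 e9 e10; lia.
have all_pre : forall p : nat, pre id z p = pre id v p.
  by apply: (pair_pre_cases vw) => // [|p pn]; rewrite ?pre0 ?pre_full.
apply/permP => i; apply: val_inj => /=.
have := all_pre i.+1; rewrite !preS all_pre => /addnI; exact.
Qed.

(** Squeezed between the full set, which gives [v], and the empty set, which gives [w]. *)
Lemma tree_vertex_in S : tree_vertex S \in bruhat_interval v w.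
Proof.
have anti S1 S2 : S1 \subset S2 -> bruhat_le (tree_vertex S2) (tree_vertex S1).
  exact: (final_anti key_inj I_ends J_ends I_cross J_later IJ_lt descent).
have t0 : tree_vertex finset.set0 = w by exact: final0.
by rewrite inE -{1}tree_vertexT -{1}t0 !anti ?finset.sub0set ?finset.subsetT.
Qed.

End Vertices.

(** * Permutations as points *)

Section Point.

Local Open Scope ring_scope.

Variables (R : realType) (n : nat).
Implicit Types (z : 'S_n) (G : {set 'I_n}).

Definition perm_point z : 'rV[R]_n := \row_i (z i).+1%:R.
Definition indicator G : 'rV[R]_n := \row_i (i \in G)%:R.

Lemma dot_perm_point G z : dot (indicator G) (perm_point z) = (content G z + #|G|)%:R.
Proof.
rewrite /dot /content -sum1_card -big_split /= natr_sum [RHS]big_mkcond /=.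
apply: eq_bigr => i _; rewrite !mxE addn1.
by case: (i \in G); rewrite ?mul1r ?mul0r.
Qed.

(** All points have the same coordinate sum, so differences lie in the kernel of the all-ones
    column. *)
Lemma perm_point_dim (A : {set 'S_n}) : (0 < n)%N ->
  exists2 U : 'M[R]_n, (\rank U <= n.-1)%N &
    forall x y, conv_hull A perm_point x -> conv_hull A perm_point y -> (x - y <= U)%MS.
Proof.
move=> n0; exists (kermx (const_mx 1 : 'cV_n)).
  rewrite mxrank_ker -subn1 leq_sub2l // lt0n mxrank_eq0.
  apply/eqP => /matrixP/(_ (Ordinal n0) 0); rewrite !mxE => /eqP.
  by rewrite oner_eq0.
have dotT x : conv_hull A perm_point x ->
    dot (indicator [set: 'I_n]%SET) x = (\sum_(i < n) i + n)%N%:R.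
  have hT z : z \in A -> dot (indicator [set: 'I_n]%SET) (perm_point z) = (\sum_(i < n) i + n)%N%:R.
    rewrite dot_perm_point cardsT card_ord (_ : content _ z = \sum_(i < n) i)%N //.
    by rewrite -(pre_total z); apply: eq_bigl => i; rewrite finset.in_setT ltn_ord.
  have hle z : z \in A -> dot (indicator [set: 'I_n]%SET) (perm_point z) <= (\sum_(i < n) i + n)%N%:R.
    by move/hT->.
  have [_ E] := conv_face hle.
  move=> Ax; have : conv_hull [set z in A | dot (indicator [set: 'I_n]) (perm_point z)
     == (\sum_(i < n) i + n)%N%:R :> R]%SET perm_point x.
    apply: conv_sub Ax; apply/fintype.subsetP => z zA; rewrite inE zA.
    by apply/eqP/hT.
  by rewrite -E => -[].
move=> x y Ax Ay; apply/sub_kermxP/matrixP => i j; rewrite !ord1 [RHS]mxE.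
transitivity (dot (indicator [set: 'I_n]%SET) (x - y)); last first.
  by rewrite dotBr (dotT _ Ax) (dotT _ Ay) subrr.
rewrite mxE; apply: eq_bigr => l _.
by rewrite [const_mx _ _ _]mxE [indicator _ _ _]mxE finset.in_setT mulr1 mul1r.
Qed.

End Point.

(** * The cubical structure given by the tree *)

Section Cube.

Local Open Scope ring_scope.

Variables (R : realType) (n : nat) (v w : 'S_n) (K0 K1 : 'I_n).
Hypothesis vw : coxeter_pair v w K0 K1.

Lemma tree_cubical :
  (forall i j : 'I_n, (i < K0 -> K1 < j ->
    (forall p : 'I_n, i < p <= K0 -> w i < w p) ->
    (forall p : 'I_n, K1 <= p < j -> w p < w j) -> w i < w j)%N) ->
  cubical n.-1 (bruhat_polytope R v w).
Proof.
move=> gap.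
pose G (k : 'I_n.-1 * bool) := (if k.2 then edge_J w K0 K1 else edge_I w K0 K1) (lift K1 k.1).
pose G' (k : 'I_n.-1 * bool) := (if k.2 then edge_J' w K0 K1 else edge_I w K0 K1) (lift K1 k.1).
have K1N h : lift K1 h != K1 by rewrite eq_sym neq_lift.
apply: (@Cubical _ n.-1 n _ (fun S => perm_point R (tree_vertex w K0 K1 S))
  (fun k => indicator R (G k)) (fun k => (content (G' k) w + #|G k|)%:R)).
- by move=> S; apply: conv_vertex; apply: tree_vertex_in.
- move=> k x Qx; apply: (conv_face _).1 Qx => z; rewrite inE => /andP[vz zw].
  rewrite dot_perm_point ler_nat leq_add2r /G /G'; case: k => h [] /=.
    exact: (edge_J_le vw vz zw (K1N h)).
  exact: (edge_I_le vw vz zw gap (K1N h)).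
- move=> [h s] S; rewrite dot_perm_point eqr_nat eqn_add2r /G /G' /=; case: s => /=.
    by rewrite (tree_vertex_J vw gap) eqb_id.
  by rewrite (tree_vertex_I vw gap) eqbF_neg.
- by apply: perm_point_dim; exact: leq_ltn_trans (ltn_ord K1).
Qed.

End Cube.

(** * The vertex w in the remaining case *)

Section Exposed.

Local Open Scope ring_scope.

Variables (R : realType) (n : nat) (v w : 'S_n) (K0 K1 : 'I_n).
Implicit Types (z : 'S_n) (e i j p q x y : 'I_n).
Hypothesis vw : coxeter_pair v w K0 K1.
Local Open Scope nat_scope.

Let K10 : K1 = K0.+1 :> nat. Proof. by case: vw. Qed.

(** These are the cuts [edge_I] away from the middle, with the bound of the common edge replaced by
    two bounds that hold whether or not there are coatoms of type (3). *)
Definition block e : {set 'I_n} := if e <= K0 then low_block w e else ~: up_block w e.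

Lemma block_le e z : z \in bruhat_interval v w -> content (block e) z <= content (block e) w.
Proof.
rewrite inE => /andP[vz zw]; rewrite /block; case: (leqP e K0) => eK.
  exact: (low_block_le vw vz zw eK).
have := up_block_ge vw vz zw (e := e); rewrite K10 => /(_ eK).
have := content_compl (up_block w e) z; have := content_compl (up_block w e) w.
lia.
Qed.

Lemma exposed_blocks (E : {set 'I_n}) (T : {set 'S_n}) :
  (forall z, z \in bruhat_interval v w ->
     (forall e, e \in E -> content (block e) z = content (block e) w) <-> z \in T) ->
  exposed (bruhat_interval v w) T (@perm_point R n).
Proof.
move=> hT; exists (\sum_(e in E) indicator R (block e))%R.
exists (\sum_(e in E) (content (block e) w + #|block e|))%:R%R => z zA.
have -> : dot (\sum_(e in E) indicator R (block e))%R (perm_point R z) =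
    ((\sum_(e in E) (content (block e) z + #|block e|))%N%:R)%R.
  by rewrite dot_suml natr_sum; apply: eq_bigr => e _; rewrite dot_perm_point.
have [le_s eq_s] : \sum_(e in E) (content (block e) z + #|block e|) <=
    \sum_(e in E) (content (block e) w + #|block e|)
    ?= iff [forall (e | e \in E), content (block e) z == content (block e) w].
  apply: leqif_sum => e _; split; last by rewrite eqn_add2r.
  by rewrite leq_add2r block_le.
rewrite ler_nat eqr_nat; split=> //; rewrite eq_s.
apply/forall_inP/idP => [h|/(hT _ zA).2 h e /h ->//].
by apply/(hT _ zA) => e /h /eqP.
Qed.

Variables (x y : 'I_n).
Hypothesis xK : x <= K0.
Hypothesis yK : K1 <= y.
Hypothesis wx : forall p, x < p <= K0 -> w x < w p.
Hypothesis wy : forall p, K1 <= p < y -> w p < w y.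

Let xy : x != y. Proof. by rewrite -val_eqE /=; lia. Qed.

(** A triangular system: the subtree at [e] consists of [e] and places farther from the middle, and
    by [wx] and [wy] it avoids [x] and [y], so [z e] follows from entries already known. *)
Lemma blocks_agree z : (forall e, e != x -> e != y -> content (block e) z = content (block e) w) ->
  forall e, e != x -> e != y -> z e = w e.
Proof.
move=> tight; have left e : e <= K0 -> e != x -> z e = w e.
  have [m] := ubnP (e : nat); elim: m e => // m IH e em eK ex.
  have ey : e != y by rewrite -val_eqE /=; lia.
  apply: val_inj; have := tight e ex ey; rewrite /block eK.
  rewrite !(content_D1 _ (low_block_refl w e)) (_ : content _ z = content (low_block w e :\ e) w); first by move/addIn.
  apply: eq_bigr => q; rewrite in_setD1 => /andP[qe /low_blockP[qle h]].
  have qe' : q < e by move: qe; rewrite -val_eqE /=; lia.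
  rewrite IH //; [by lia|by lia|].
  apply/eqP => qx; have := h q; rewrite leqnn qe' => /(_ isT).
  by have := wx (p := e); rewrite -qx qe' eK => /(_ isT); lia.
have right e : K1 <= e -> e != y -> z e = w e.
  have [m] := ubnP (n - e); elim: m e => // m IH e em eK ey.
  have ex : e != x by rewrite -val_eqE /=; lia.
  apply: val_inj => /=; have := tight e ex ey; rewrite /block (_ : (e <= K0) = false); last by lia.
  have := content_compl (up_block w e) z; have := content_compl (up_block w e) w.
  rewrite !(content_D1 _ (up_block_refl w e)) (_ : content (_ :\ _) z = content (up_block w e :\ e) w); first by lia.
  apply: eq_bigr => q; rewrite in_setD1 => /andP[qe /up_blockP[qle h]].
  have qe' : e < q by move: qe; rewrite -val_eqE /=; lia.
  rewrite IH //; [by have := ltn_ord q; lia|by lia|].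
  apply/eqP => qy; have := h q; rewrite leqnn qe' => /(_ isT).
  by have := wy (p := e); rewrite -qy qe' eK => /(_ isT); lia.
by move=> e ex ey; case: (leqP e K0) => h; [apply: left|apply: right]; rewrite ?K10.
Qed.

Lemma agree_tperm z : (forall e, e != x -> e != y -> z e = w e) ->
  z \in [set w; w \ou tperm x y]%SET.
Proof.
move=> h; have pre2 e : (e == x) || (e == y) -> z e = w x \/ z e = w y.
  move=> exy; pose q := (w^-1)%g (z e); have wq : w q = z e by rewrite permKV.
  have [qx|qx] := eqVneq q x; first by left; rewrite -wq qx.
  have [qy|qy] := eqVneq q y; first by right; rewrite -wq qy.
  have := h q qx qy; rewrite wq => /perm_inj qe.
  by move: exy; rewrite -qe (negPf qx) (negPf qy).
rewrite !inE; apply/orP.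
have zxy : z x != z y by rewrite (inj_eq perm_inj).
have [hx|hx] := pre2 x ltac:(by rewrite eqxx); have [hy|hy] := pre2 y ltac:(by rewrite eqxx orbT).
- by rewrite hx hy eqxx in zxy.
- left; apply/eqP/permP => e; have [->//|ex] := eqVneq e x.
  by have [->//|ey] := eqVneq e y; apply: h.
- right; apply/eqP/permP => e; rewrite pmulE; case: tpermP => [->|->|/eqP ex /eqP ey] //.
  exact: h.
- by rewrite hx hy eqxx in zxy.
Qed.

Lemma block_tperm e : e != x -> e != y -> content (block e) (w \ou tperm x y) = content (block e) w.
Proof.
move=> ex ey; apply: content_tperm_stable; rewrite /block; case: (leqP e K0) => eK.
  rewrite [y \in _](notin_low w); last by lia.
  apply/negbTE/negP => /low_blockP[xe h].
  have xe' : x < e by move: ex; rewrite -val_eqE /=; lia.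
  by have := h x; have := wx (p := e); lia.
rewrite !finset.in_setC; congr (~~ _).
rewrite [x \in _](notin_up w); last by lia.
apply/esym/negbTE/negP => /up_blockP[ye h].
have ye' : e < y by move: ey; rewrite -val_eqE /=; lia.
by have := h y; have := wy (p := e); lia.
Qed.

Lemma exposed_edge :
  exposed (bruhat_interval v w) [set w; w \ou tperm x y]%SET (@perm_point R n).
Proof.
apply: (@exposed_blocks [set e | (e != x) && (e != y)]%SET) => z _; split=> [h|].
  by apply/agree_tperm/blocks_agree => e ex ey; apply: h; rewrite inE ex.
rewrite !inE => /orP[]/eqP-> // e; rewrite inE => /andP[].
exact: block_tperm.
Qed.

End Exposed.

Section ExposedVertex.

Local Open Scope ring_scope.

Variables (R : realType) (n : nat) (v w : 'S_n) (K0 K1 : 'I_n).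
Hypothesis vw : coxeter_pair v w K0 K1.
Local Open Scope nat_scope.

(** Tightness away from [K0] and [K1] leaves [w] and its exchange at these two places; the block of
    [K0] excludes the latter. *)
Lemma exposed_vertex : exposed (bruhat_interval v w) [set w]%SET (@perm_point R n).
Proof.
have [K10 _ _ wK1 _] := vw.
apply: (@exposed_blocks R _ _ _ _ _ vw [set: 'I_n]%SET) => z _; split=> [h|].
  have : z \in [set w; w \ou tperm K0 K1]%SET.
    apply: (agree_tperm vw) => // e eK0 eK1.
    apply: (blocks_agree vw (leqnn K0) (leqnn K1)) => // [p|p|e' _ _]; [lia|lia|].
    by apply: h; rewrite finset.in_setT.
  rewrite !inE => /orP[//|/eqP zE]; have := h K0 (finset.in_setT _).
  rewrite /block leqnn zE => E.
  have := content_tperm w (low_block_refl w K0) (_ : K1 \notin low_block w K0).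
  by rewrite notin_low ?K10 // E => /(_ isT)/addnI e; have := wK1 K0 (leqnn _); rewrite e ltnn.
by rewrite inE => /eqP->.
Qed.

End ExposedVertex.

(** * Four edges at [w] with a linear relation *)

Section NotCubeInterval.

Local Open Scope ring_scope.

Variables (R : realType) (n : nat) (v w : 'S_n) (K0 K1 : 'I_n).
Implicit Types (i j p q : 'I_n).
Hypothesis vw : coxeter_pair v w K0 K1.

Lemma perm_point_tperm i j : i != j ->
  perm_point R (w \ou tperm i j) - perm_point R w =
  ((w i)%:R - (w j)%:R) *: (delta_mx 0 j - delta_mx 0 i).
Proof.
move=> ij; apply/rowP => p; rewrite !mxE eqxx /= pmulE -!natr1.
case: tpermP => [->|->|/eqP pi /eqP pj].
- by rewrite eqxx (negPf ij) /=; ring.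
- by rewrite eqxx [j == i]eq_sym (negPf ij) /=; ring.
- by rewrite (negPf pi) (negPf pj) /=; ring.
Qed.

Lemma edge_in_interval i j : (i < j)%N -> (w j < w i)%N ->
  (forall q, i <= q < j -> q <= K0 -> w i <= w q)%N ->
  (forall p, i < p <= j -> K1 <= p -> w p <= w j)%N ->
  w \ou tperm i j \in bruhat_interval v w.
Proof.
move=> ij wij h1 h2; rewrite inE (pair_le_tperm vw ij wij).2 //=.
rewrite -{2}[w](pmul_tpermK w i j); apply: bruhat_tperm => //.
by rewrite !pmulE tpermL tpermR.
Qed.

Lemma interval_not_cube i j : (i < K0)%N -> (K1 < j)%N -> (w j < w i)%N ->
  (forall p, i < p <= K0 -> w i < w p)%N -> (forall p, K1 <= p < j -> w p < w j)%N ->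
  ~ exists d, comb_equiv (bruhat_polytope R v w) (cube R d).
Proof.
have [K10 _ _ wK1 wK0] := vw.
move=> iK jK wij hi hj.
have K01 : (K0 < K1)%N by rewrite K10.
have wi1 := wK1 i (ltnW iK); have w01 := wK1 K0 (leqnn _); have w0j := wK0 j (ltnW jK).
have iK1 : (i < K1)%N by rewrite K10 ltnS ltnW.
have K0j : (K0 < j)%N by rewrite -ltnS -K10 ltnW.
have none0 p : (K0 < p <= K0 -> w K0 < w p)%N by lia.
have none1 p : (K1 <= p < K1 -> w p < w K1)%N by lia.
have low q : (i <= q -> q <= K0 -> w i <= w q)%N.
  by move=> iq qK; have [<-//|qi] := eqVneq i q; apply/ltnW/hi; move: qi; rewrite -val_eqE /=; lia.
have up p : (p <= j -> K1 <= p -> w p <= w j)%N.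
  by move=> pj Kp; have [->//|qi] := eqVneq p j; apply/ltnW/hj; move: qi; rewrite -val_eqE /=; lia.
have eqK0 q : (K0 <= q -> q <= K0 -> q = K0)%N by move=> *; apply: val_inj => /=; lia.
have eqK1 q : (K1 <= q -> q <= K1 -> q = K1)%N by move=> *; apply: val_inj => /=; lia.
have neij : i != j by rewrite -val_eqE /=; lia.
have neK : K0 != K1 by rewrite -val_eqE /=; lia.
have nei1 : i != K1 by rewrite -val_eqE /=; lia.
have ne0j : K0 != j by rewrite -val_eqE /=; lia.
have nei0 : i != K0 by rewrite -val_eqE /=; lia.
have ne1j : K1 != j by rewrite -val_eqE /=; lia.
pose z1 := w \ou tperm K0 K1; pose z2 := w \ou tperm i K1.
pose z3 := w \ou tperm K0 j; pose z4 := w \ou tperm i j.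
have ww : w \in bruhat_interval v w by rewrite inE (pair_le vw) bruhat_refl.
have i1 : z1 \in bruhat_interval v w.
  apply: edge_in_interval => // [q|p]; first by case/andP=> h _ h'; rewrite (eqK0 _ h h').
  by case/andP=> _ h h'; rewrite (eqK1 _ h' h).
have i2 : z2 \in bruhat_interval v w.
  apply: edge_in_interval => // [q|p]; first by case/andP=> h _; apply: low.
  by case/andP=> _ h h'; rewrite (eqK1 _ h' h).
have i3 : z3 \in bruhat_interval v w.
  apply: edge_in_interval => // [q|p]; first by case/andP=> h _ h'; rewrite (eqK0 _ h h').
  by case/andP=> _; apply: up.
have i4 : z4 \in bruhat_interval v w.
  apply: edge_in_interval => // [|q|p]; [exact: ltn_trans K0j| |].
    by case/andP=> h _; apply: low.
  by case/andP=> _; apply: up.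
have gt0 (a b : nat) : (a < b)%N -> 0 < (b%:R - a%:R)^-1 :> R.
  by move=> ab; rewrite invr_gt0 subr_gt0 ltr_nat.
(* The coefficients are the inverse drops, which normalise each edge at [w] to a difference of unit
   vectors. *)
apply: (@not_cube R _ n (bruhat_interval v w) (@perm_point R n) w z1 z2 z3 z4
  ((w K0)%:R - (w K1)%:R)^-1 ((w i)%:R - (w K1)%:R)^-1
  ((w K0)%:R - (w j)%:R)^-1 ((w i)%:R - (w j)%:R)^-1).
- by apply/fintype.subsetP => z; rewrite !finset.in_setU !finset.in_set1 => /orP[/orP[/orP[/orP[]|]|]|] /eqP->.
- rewrite !inE !negb_or; apply/andP; split; first (apply/andP; split).
  + by apply/eqP => /permP/(_ K0); rewrite pmulE tpermL => /perm_inj E; rewrite E eqxx in neK.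
  + apply/eqP => /permP/(_ i); rewrite !pmulE tpermL tpermD 1?eq_sym // => /perm_inj E.
    by rewrite E eqxx in nei1.
  + apply/eqP => /permP/(_ j); rewrite !pmulE tpermR tpermD // => /perm_inj E.
    by rewrite E eqxx in ne0j.
- by apply/eqP => /permP/(_ i); rewrite pmulE tpermL => /perm_inj E; rewrite E eqxx in nei1.
- by apply/eqP => /permP/(_ j); rewrite pmulE tpermR => /perm_inj E; rewrite E eqxx in ne0j.
- exact: (exposed_vertex R vw).
- exact: (exposed_edge R vw (leqnn K0) (leqnn K1) none0 none1).
- exact: (exposed_edge R vw (ltnW iK) (leqnn K1) hi none1).
- exact: (exposed_edge R vw (leqnn K0) (ltnW jK) none0 hj).
- exact: gt0.
- exact: gt0.
- rewrite !perm_point_tperm // !scalerA !mulVf ?scale1r; first by rewrite addrACA [RHS]addrACA; congr (_ + _); apply: addrC.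
all: by rewrite subr_eq0 eqr_nat gtn_eqF.
Qed.

End NotCubeInterval.

Theorem proposition8p4 (R : realType) (n k : nat) (v w : 'S_n)
    (hn : 4 <= n) (hk : 2 <= k <= n - 2)
    (hw : w = v \ou (\big[@pmul n/1%g]_(a <- index_iota 1 k) s_ n a)
                \ou (\big[@pmul n/1%g]_(a <- rev (index_iota k n)) s_ n a))
    (hl : ell w - ell v = n - 1) :
  (forall i j : 'I_n, i < j ->
     ((ell (w \ou tperm i j)).+1 = ell w <->
      w j < w i /\ forall p : 'I_n, i < p < j -> ~~ (w j <= w p <= w i)))
  /\
  (forall i j : 'I_n, i < j -> (ell (w \ou tperm i j)).+1 = ell w ->
     (coatom v w (w \ou tperm i j) <->
      [\/ (1 <= i.+1 /\ i.+1 < j.+1 <= k.+1) /\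
          (forall p : 'I_n, i < p < j -> w i < w p),
          (k <= i.+1 /\ i.+1 < j.+1 <= n) /\
          (forall p : 'I_n, i < p < j -> w p < w j)
        | (1 <= i.+1 < k /\ k.+1 < j.+1 <= n) /\
          (forall p : 'I_n, i.+1 < p.+1 <= k -> w i < w p) /\
          (forall p : 'I_n, k < p.+1 < j.+1 -> w p < w j)]))
  /\
  ((exists d : nat, comb_equiv (bruhat_polytope R v w) (cube R d)) <->
   ~ exists i j : 'I_n,
       [/\ i < j, (ell (w \ou tperm i j)).+1 = ell w,
           1 <= i.+1 < k /\ k.+1 < j.+1 <= n,
           forall p : 'I_n, i.+1 < p.+1 <= k -> w i < w p
         & forall p : 'I_n, k < p.+1 < j.+1 -> w p < w j]).
Proof.
(* As [n - 1] is positive, the truncated subtraction in [hl] is a genuine one. *)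
have [|K0 [K1 [K1k vw]]] := coxeter_pairP hk hw; first by lia.
have [K10 _ _ wK1 wK0] := vw.
split; first by move=> i j; apply: ell_cover.
split=> [i j ij E|].
  have [wij _] := (ell_cover w ij).1 E.
  have jn := ltn_ord j.
  rewrite (pair_coatom vw ij E); split=> [[hL hR]|[[[_ ijk] h]|[[ki ijn] h]|[[ik jk] [hL hR]]]].
  - have neq (p : 'I_n) : i < p < j -> w p <> w i :> nat /\ w p <> w j :> nat.
      move=> ipj; have pi : p != i by rewrite -val_eqE /=; lia.
      have pj : p != j by rewrite -val_eqE /=; lia.
      by have := perm_neq w pi; have := perm_neq w pj; lia.
    case: (leqP j k) => jk.
      by apply: Or31; split=> [|p ipj]; [lia|have := neq p ipj; have := hL p; lia].
    case: (leqP k i.+1) => ik.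
      by apply: Or32; split=> [|p ipj]; [lia|have := neq p ipj; have := hR p; lia].
    apply: Or33; split; first by lia.
    split=> p ipj; first by have := neq p; have := hL p; lia.
    by have := neq p; have := hR p; lia.
  - split=> [q iqj qK|p ipj pK].
      by have [->|qi] := eqVneq q i; [|apply/ltnW/h; move: qi; rewrite -val_eqE /=; lia].
    have [->|pj] := eqVneq p j; first by [].
    by move: pj; rewrite -val_eqE /=; lia.
  - split=> [q iqj qK|p ipj pK].
      have [->|qi] := eqVneq q i; first by [].
      by move: qi; rewrite -val_eqE /=; lia.
    by have [->|pj] := eqVneq p j; [|apply/ltnW/h; move: pj; rewrite -val_eqE /=; lia].
  - split=> [q iqj qK|p ipj pK].
      by have [->|qi] := eqVneq q i; [|apply/ltnW/hL; move: qi; rewrite -val_eqE /=; lia].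
    by have [->|pj] := eqVneq p j; [|apply/ltnW/hR; move: pj; rewrite -val_eqE /=; lia].
split=> [cubeQ [i [j [ij E ikj hi hj]]]|no].
  have [wij _] := (ell_cover w ij).1 E.
  apply: (interval_not_cube vw _ _ wij) cubeQ; try lia.
    by move=> p ip; apply: hi; lia.
  by move=> p pj; apply: hj; lia.
have d0 : 0 < n.-1 by lia.
exists n.-1; apply: (cubical_equiv d0 _ (cube_cubical R n.-1)).
(* A violation of the gap condition has all intermediate entries outside [[w j, w i]], so it is a
   cover satisfying (3). *)
apply: (tree_cubical _ vw) => i j iK jK hi hj; rewrite ltnNge; apply/negP => wji.
have ij : i < j by lia.
have neij : i != j by rewrite -val_eqE /=; lia.
have wij := perm_neq w neij.
case: no; exists i, j; split=> //; [|by have := ltn_ord j; lia|by move=> p ip; apply: hi; lia|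
  by move=> p pj; apply: hj; lia].
apply/(ell_cover w ij); split=> [|p ipj]; first by lia.
case: (leqP p K0) => pK; first by have := hi p; lia.
by have := hj p; lia.
Qed.
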